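(* Let $M=(\mathcal{S},\mathcal{X},\{\mathcal{T}^{(x)}\})$ be an irreducible (finite) edge-emitting hidden Markov model, and let $h$ and $h(t)$ denote the entropy rate and the length-$t$ entropy rate estimate of its stationary output process. Suppose that for some $n\in\mathbb{N}$ relatively prime to $\mathrm{per}(M)$ the block model $M^n$ is flag-state. Then $$\limsup_{t\to\infty}\,\{h(t)-h\}^{1/t}\;\le\;\alpha^{1/n},$$ where $0<\alpha<1$ is the flag-state rate $\alpha=\alpha(M^n)$ of the block model $M^n$ (defined in the context). In particular, if $M$ is path-mergeable, then the estimates $h(t)$ converge to $h$ exponentially, i.e. $\limsup_{t\to\infty}\{h(t)-h\}^{1/t}<1$.
   Context: Edge-emitting HMM: a triple $(\mathcal{S},\mathcal{X},\{\mathcal{T}^{(x)}\}_{x\in\mathcal{X}})$ with $\mathcal{S}$ a finite set of states, $\mathcal{X}$ a finite alphabet, and $\mathcal{T}^{(x)}$ nonnegative $|\mathcal{S}|\times|\mathcal{S}|$ matrices whose sum $\mathcal{T}=\sum_x\mathcal{T}^{(x)}$ is stochastic. It generates a state-symbol sequence $(S_t,X_t)_{t\ge0}$ with $\mathbb{P}(S_{t+1}=j,X_t=x\mid S_t=i,\text{past})=\mathcal{T}^{(x)}_{ij}$. Standing assumptions: the HMM is irreducible (the Markov chain with transition matrix $\mathcal{T}$ is irreducible), and each $x\in\mathcal{X}$ can be generated with positive probability from at least one state. $\pi$ is the unique stationary distribution of $\mathcal{T}$; $\mathbb{P}$ is the stationary measure on state-symbol sequences with $S_0\sim\pi$; $\mathbb{P}_i(\cdot)=\mathbb{P}(\cdot\mid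 S_0=i)$. For a word $w\in\mathcal{X}^*$ of length $|w|$, $\mathbb{P}(w)=\mathbb{P}(X_0^{|w|-1}=w)$ and $\mathbb{P}_i(w)=\mathbb{P}_i(X_0^{|w|-1}=w)$, where $X_a^b=X_a,\dots,X_b$. $\mathcal{L}_n(M)$ is the set of words $w$ of length $n$ with $\mathbb{P}(w)>0$. Entropy rate and block estimates: with $(X_t)$ having law $\mathbb{P}$ and Shannon entropy $H$ in base 2, $h=\lim_{t\to\infty}H(X_1^t)/t$ and $h(t)=H(X_t\mid X_1^{t-1})$; one has $h(t)\searrow h$. $\delta_i(w)=\{j\in\mathcal{S}:\mathbb{P}_i(X_0^{|w|-1}=w,\,S_{|w|}=j)>0\}$, with $\delta_i(\lambda)=\{i\}$ for the empty word $\lambda$. Path-mergeable: for each pair of distinct states $i,j$ there exist a word $w$ and a state $k$ with $k\in\delta_i(w)\cap\delta_j(w)$. Flag-state: a symbol $x$ is a flag symbol for state $k$ if $k\in\delta_i(x)$ for all $i$ with $\delta_i(x)\neq\emptyset$; an HMM is flag-state if every state has some flag symbol. $\mathrm{per}(M)$ is the period of the irreducible Markov chain $\mathcal{T}$ (the gcd of cycle lengths in its directed graph). $\mathbb{N}=\{1,2,\dots\}$. Block model: for $n\in\mathbb{N}$, $M^n=(\mathcal{S},\mathcal{W},\{\mathcal{Q}^{(w)}\})$ is the edge-emitting HMM with $\mathcal{W}=\mathcal{L}_n(M)$ and $\mathcal{Q}^{(w)}_{ij}=\mathbb{P}_i(X_0^{n-1}=w,S_n=j)$. If $M$ is irreducible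 and $n$ is relatively prime to $\mathrm{per}(M)$ then $M^n$ is irreducible with the same stationary distribution $\pi$. Flag-state rate: for an irreducible flag-state edge-emitting HMM $(\mathcal{S},\mathcal{X},\{\mathcal{T}^{(x)}\})$, fix a flag symbol $y_j$ for each state $j$, and set $p_*=\min_j\mathbb{P}(X_0=y_j\mid S_1=j)$, $q_*=\min_j\min_{i:\mathbb{P}_i(y_j)>0}\mathbb{P}_i(S_1=j\mid X_0=y_j)$, $r_*=\min_{i,j}\pi_i/\pi_j$, $\eta=\frac{p_*r_*}{2|\mathcal{S}|}$, $\alpha_1=\exp\!\left(-\frac{p_*^2r_*^2}{2|\mathcal{S}|^2}\right)$, $\alpha_2=(1-q_*^2)^{\eta}$, and $\alpha=\max\{\alpha_1,\alpha_2\}$. The rate $\alpha(M^n)$ is this $\alpha$ computed for the HMM $M^n$ (with its alphabet $\mathcal{W}$, its matrices $\mathcal{Q}^{(w)}$, and a fixed choice of flag symbols for $M^n$). *)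

(* Defs.v *)
From HB Require Import structures.
From mathcomp Require Import all_boot all_order all_algebra.
From mathcomp Require Import all_classical all_reals all_analysis.

Set Implicit Arguments.
Unset Strict Implicit.
Unset Printing Implicit Defensive.

Import Order.TTheory GRing.Theory Num.Theory.
Import numFieldNormedType.Exports.
Local Open Scope ring_scope.

(** The triple (S, X, {T^(x)}); [trans x] is the matrix T^(x), indexed by the
    states. The requirements on the matrices are in [is_hmm], so that the block
    model below is plain data and needs no proof to be formed. *)
Record edge_hmm (R : realType) := EdgeHMM {
  state : finType;
  symbol : finType;
  trans : symbol -> state -> state -> R }.

Section EdgeHMM.
Context {R : realType}.
Implicit Type M : edge_hmm R.

Definition transM M (i j : state M) : R := \sum_(x : symbol M) trans x i j.

(** There is no stationary distribution on an empty set of states. *)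
Definition is_hmm M : Prop :=
  [/\ (0 < #|state M|)%N,
      forall (x : symbol M) i j, 0 <= trans x i j
    & forall i : state M, \sum_(j : state M) transM i j = 1].

Definition tgraph M : rel (state M) := fun i j => 0 < transM i j.

Definition irreducible_hmm M : Prop :=
  forall i j : state M, connect (@tgraph M) i j.

Definition all_symbols_occur M : Prop :=
  forall x : symbol M, exists i : state M, 0 < \sum_(j : state M) trans x i j.

(** The gcd of the lengths of the simple directed cycles (self-loops included)
    of the graph; every closed walk decomposes into such cycles. *)
Definition per M : nat :=
  \big[gcdn/0%N]_(l < #|state M|
     | [exists c : l.+1.-tuple (state M), ucycleb (@tgraph M) c]) l.+1.

Definition is_stationary M (p : {ffun state M -> R}) : Prop :=
  [/\ forall i, 0 <= p i,
      \sum_(i : state M) p i = 1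
    & forall j, \sum_(i : state M) p i * transM i j = p j].

(** The stationary distribution; it exists and is unique for an irreducible HMM. *)
Definition stat M : {ffun state M -> R} :=
  xget [ffun=> 0] [set p | is_stationary p]%classic.

(** A trajectory S_0, ..., S_N together with X_0, ..., X_{N-1}. All events
    below depend on finitely many coordinates, so the stationary measure is
    given by its finite-dimensional distributions: [Pr A] is the probability
    of an event A about (S_0^N, X_0^{N-1}). *)
Definition traj M (N : nat) : finType :=
  (N.+1.-tuple (state M) * N.-tuple (symbol M))%type.

Definition log2 (x : R) : R := ln x / ln 2.

Section Horizon.
Variables (M : edge_hmm R) (N : nat).
Implicit Types (o : traj M N) (A B : pred (traj M N)).

Definition first_state o : state M := tnth o.1 ord0.
Definition last_state o : state M := tnth o.1 ord_max.

Definition traj_pr o : R :=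
  stat M (first_state o) *
  \prod_(t < N) trans (tnth o.2 t)
    (tnth o.1 (widen_ord (leqnSn N) t)) (tnth o.1 (lift ord0 t)).

Definition Pr A : R := \sum_(o | A o) traj_pr o.

(** P(A | B), with value 0 when P(B) = 0. *)
Definition condPr A B : R := Pr [pred o | A o && B o] / Pr B.

(** P_i = P(. | S_0 = i) *)
Definition Pr_from (i : state M) A : R := condPr A [pred o | first_state o == i].

(** As ln 0 = 0 in the library, 0 log 0 = 0. *)
Definition entropy (T : finType) (Y : traj M N -> T) : R :=
  - \sum_(a : T) Pr [pred o | Y o == a] * log2 (Pr [pred o | Y o == a]).

Definition cond_entropy (T U : finType)
    (Y : traj M N -> T) (Z : traj M N -> U) : R :=
  \sum_(b : U) Pr [pred o | Z o == b] *
    - \sum_(a : T) condPr [pred o | Y o == a] [pred o | Z o == b] *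
        log2 (condPr [pred o | Y o == a] [pred o | Z o == b]).

End Horizon.

Arguments first_state {M N}.
Arguments last_state {M N}.
Arguments Pr {M N}.
Arguments condPr {M N}.
Arguments Pr_from {M N}.

(** The word X_a, ..., X_{a+m-1}; meaningful for a + m <= N + 1. *)
Definition word_at M N (a m : nat) (o : traj M N.+1) : m.-tuple (symbol M) :=
  [tuple tnth o.2 (inord (a + i)) | i < m].

(** H(X_1^t) *)
Definition block_entropy M (t : nat) : R := entropy (@word_at M t 1 t).

Definition entropy_rate M : R :=
  limn (fun t : nat => block_entropy M t / t%:R).

(** H(X_t | X_1^{t-1}) for t >= 1. *)
Definition entropy_estimate M (t : nat) : R :=
  cond_entropy (fun o : traj M t.+1 => tnth o.2 ord_max) (@word_at M t 1 t.-1).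

Definition word_pr M n (w : n.-tuple (symbol M)) : R :=
  Pr [pred o : traj M n | o.2 == w].

Definition word_pr_from M n (i : state M) (w : n.-tuple (symbol M)) : R :=
  Pr_from i [pred o : traj M n | o.2 == w].

(** P_i(X_0^{n-1} = w, S_n = j) *)
Definition word_end_pr M n (i : state M) (w : n.-tuple (symbol M))
    (j : state M) : R :=
  Pr_from i [pred o : traj M n | (o.2 == w) && (last_state o == j)].

Definition delta M (i : state M) (w : seq (symbol M)) : {set state M} :=
  [set j | 0 < word_end_pr i (in_tuple w) j].

Definition path_mergeable M : Prop :=
  forall i j : state M, i != j ->
    exists (w : seq (symbol M)) (k : state M), k \in delta i w :&: delta j w.

Definition flag_symbol M (x : symbol M) (k : state M) : Prop :=
  forall i : state M, delta i [:: x] != finset.set0 -> k \in delta i [:: x].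

Definition flag_state M : Prop :=
  forall k : state M, exists x : symbol M, flag_symbol x k.

(** M^n, whose symbols are the words of length n of positive probability. *)
Definition block_model M (n : nat) : edge_hmm R :=
  @EdgeHMM R (state M) {w : n.-tuple (symbol M) | 0 < word_pr w}
    (fun w i j => word_end_pr i (val w) j).

(** Starting the iterated minima at 1 does not change them: the quantities in
    [p_star] and [q_star] are probabilities, and those in [r_star] include the
    value 1 (at i = j). *)
Section FlagRate.
Variables (M : edge_hmm R) (y : state M -> symbol M).

Definition p_star : R :=
  \big[Order.min/1]_(j : state M)
    condPr [pred o : traj M 1 | tnth o.2 ord0 == y j]
           [pred o : traj M 1 | last_state o == j].

(** P_i(S_1 = j | X_0 = y_j) is P_i(X_0 = y_j, S_1 = j) / P_i(X_0 = y_j). *)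
Definition q_star : R :=
  \big[Order.min/1]_(j : state M)
    \big[Order.min/1]_(i : state M | 0 < word_pr_from i [tuple y j])
      (word_end_pr i [tuple y j] j / word_pr_from i [tuple y j]).

Definition r_star : R :=
  \big[Order.min/1]_(i : state M) \big[Order.min/1]_(j : state M)
    (stat M i / stat M j).

Definition eta_rate : R := p_star * r_star / (2 * #|state M|%:R).

Definition alpha1 : R :=
  expR (- (p_star ^+ 2 * r_star ^+ 2 / (2 * #|state M|%:R ^+ 2))).

Definition alpha2 : R := (1 - q_star ^+ 2) `^ eta_rate.

Definition flag_rate : R := Order.max alpha1 alpha2.

End FlagRate.

(** limsup_t (h(t) - h)^(1/t), in the extended reals *)
Definition estimate_limsup M : \bar R :=
  limn_esup (fun t : nat =>
    ((entropy_estimate M t - entropy_rate M) `^ (t%:R^-1))%:E).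

End EdgeHMM.

Arguments state {R} _.
Arguments symbol {R} _.

(* Main.v *)
Require Import Defs.
From HB Require Import structures.
From mathcomp Require Import all_boot all_order all_algebra.
From mathcomp Require Import all_classical all_reals all_analysis.
From mathcomp Require Import ring lra zify.

(** Fix flag words y_j of length n. The idea is to read the process backwards in
    blocks of length n. Call states i, k delta-close for a word w if the
    predictions of the next symbol given w from i and from k differ by at most
    delta. Prepending any block to w replaces both predictions by mixtures of the
    old ones, so it cannot increase delta. If j is the state maximizing P_j(w) and
    the block is y_j, both mixtures put mass at least q_* on j, so delta shrinks by
    the factor 1 - q_*^2. Given w, the block y_j has conditional probability at
    least c = p_* r_* / |S|, so after m blocks the mean of delta is at most
    (1 - c q_*^2)^m, and h(t) - h is bounded by a constant times this mean.
    Finally 1 - c q_*^2 <= max(alpha_1, alpha_2), by elementary inequalities for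
    exp rather than a large deviation bound.

    If M is path-mergeable, the states can be merged one after the other into a
    single one by a common word; continuing it to any given state yields flag
    words, and these remain flag words when extended at the front. *)

Set Implicit Arguments.
Unset Strict Implicit.
Unset Printing Implicit Defensive.

Import Order.TTheory GRing.Theory Num.Theory.
Import numFieldNormedType.Exports.
Local Open Scope ring_scope.

(** * Sums over words of fixed length *)

Section TupleSums.
Context {R : realType} {T : finType}.
Implicit Type F : seq T -> R.

Lemma sum_tuple0 F : \sum_(w : 0.-tuple T) F w = F [::].
Proof.
rewrite (bigD1 [tuple]) //= big1 ?addr0 // => w /eqP[].
exact: tuple0.
Qed.

Lemma sum_tuple_cons n (F : n.+1.-tuple T -> R) :
  \sum_(w : n.+1.-tuple T) F w =
  \sum_x \sum_(w : n.-tuple T) F [tuple of x :: w].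
Proof.
rewrite pair_bigA /= (reindex (fun p : T * n.-tuple T => [tuple of p.1 :: p.2])) //=.
exists (fun w : n.+1.-tuple T => (thead w, [tuple of behead w])) => [[x w] _|w _] /=.
  by congr (_, _); apply/val_inj.
by case/tupleP: w => x w; apply/val_inj.
Qed.

(** The summand lives on lists, so that concatenated words need no casts between tuple types. *)
Lemma sum_tupleS n F :
  \sum_(w : n.+1.-tuple T) F w = \sum_x \sum_(w : n.-tuple T) F (x :: w).
Proof. by rewrite sum_tuple_cons. Qed.

Lemma sum_tupleD m n F :
  \sum_(w : (m + n).-tuple T) F w =
  \sum_(u : m.-tuple T) \sum_(v : n.-tuple T) F (u ++ v).
Proof.
elim: m F => [|m IH] F.
  by rewrite (sum_tuple0 (fun u => \sum_(v : n.-tuple T) F (u ++ v))).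
rewrite addSn sum_tupleS.
rewrite (sum_tupleS m (fun u => \sum_(v : n.-tuple T) F (u ++ v))).
by apply: eq_bigr => x _; rewrite (IH (fun w => F (x :: w))).
Qed.

Lemma sum_tupleSr n F :
  \sum_(w : n.+1.-tuple T) F w = \sum_(w : n.-tuple T) \sum_x F (rcons w x).
Proof.
rewrite -addn1 sum_tupleD; apply: eq_bigr => w _.
rewrite (sum_tupleS 0 (fun v => F (w ++ v))); apply: eq_bigr => x _.
by rewrite (sum_tuple0 (fun v => F (w ++ x :: v))) cats1.
Qed.

End TupleSums.

(** * Word probabilities as matrix products and as sums over state paths *)

(* [word_mx w i j], [emit w i] and [word_wt w] are the paper's
   P_i(X_0^{|w|-1} = w, S_{|w|} = j), P_i(w) and P(w). *)
Section WordWeights.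
Context {R : realType} (M : edge_hmm R).
Implicit Types (u v w : seq (symbol M)) (i j k : state M).

Fixpoint word_mx w i j : R :=
  if w is x :: w' then \sum_k trans x i k * word_mx w' k j else (i == j)%:R.

Definition emit w i : R := \sum_j word_mx w i j.

Definition word_wt w : R := \sum_i stat M i * emit w i.

Lemma sum_delta_l (i : state M) (F : state M -> R) :
  \sum_k (i == k)%:R * F k = F i.
Proof.
rewrite (bigD1 i) //= eqxx mul1r big1 ?addr0 // => k ki.
by rewrite eq_sym (negPf ki) mul0r.
Qed.

Lemma word_mx_cat u v i j :
  word_mx (u ++ v) i j = \sum_k word_mx u i k * word_mx v k j.
Proof.
elim: u i => [|x u IH] i /=; first by rewrite sum_delta_l.
under eq_bigr do rewrite IH mulr_sumr.
rewrite exchange_big /=; apply: eq_bigr => k _.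
by rewrite mulr_suml; apply: eq_bigr => l _; rewrite mulrA.
Qed.

Lemma emit_cat u v i : emit (u ++ v) i = \sum_k word_mx u i k * emit v k.
Proof.
rewrite /emit; under eq_bigr do rewrite word_mx_cat.
by rewrite exchange_big /=; apply: eq_bigr => k _; rewrite mulr_sumr.
Qed.

Lemma emit_nil i : emit [::] i = 1.
Proof.
rewrite /emit /=; under eq_bigr do rewrite -[_%:R]mulr1.
exact: (sum_delta_l i (fun=> 1)).
Qed.

Lemma word_mx1 x i j : word_mx [:: x] i j = trans x i j.
Proof.
rewrite /= (bigD1 j) //= eqxx mulr1 big1 ?addr0 // => k /negPf ->.
by rewrite mulr0.
Qed.

(** Probability, from [i], of emitting [w] while visiting [s]. For lists of equal length the default
    1 is reached only when both are empty. *)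
Fixpoint path_wt i (s : seq (state M)) w {struct w} : R :=
  match w, s with
  | x :: w', k :: s' => trans x i k * path_wt k s' w'
  | _, _ => 1
  end.

(** Expands the matrix product over intermediate states; [g] later encodes an event about the final
    state. *)
Lemma sum_path_wt N i (w : N.-tuple (symbol M)) (g : state M -> R) :
  \sum_(s : N.-tuple (state M)) path_wt i s w * g (last i s) =
  \sum_j word_mx w i j * g j.
Proof.
elim: N i w => [|N IH] i w.
  rewrite (sum_tuple0 (fun s => path_wt i s w * g (last i s))) tuple0 /= mul1r.
  by rewrite sum_delta_l.
case/tupleP: w => x w.
rewrite (sum_tupleS N (fun s => path_wt i s (x :: w) * g (last i s))) /=.
under eq_bigr => k _ do [under eq_bigr do rewrite /= -mulrA;
  rewrite -mulr_sumr IH mulr_sumr].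
rewrite exchange_big /=; apply: eq_bigr => j _.
by rewrite mulr_suml; apply: eq_bigr => k _; rewrite mulrA.
Qed.

Lemma prod_path_wt N i (s : N.-tuple (state M)) (w : N.-tuple (symbol M)) :
  \prod_(t < N) trans (tnth w t)
    (tnth [tuple of i :: s] (widen_ord (leqnSn N) t))
    (tnth [tuple of i :: s] (lift ord0 t)) = path_wt i s w.
Proof.
elim: N i s w => [|N IH] i s w; first by rewrite big_ord0 (size0nil (size_tuple w)).
case/tupleP: s => k s; case/tupleP: w => x w.
rewrite big_ord_recl /= -IH.
congr (trans _ _ _ * _); apply: eq_bigr => t _.
congr (trans _ _ _).
- by rewrite tnthS.
- rewrite !(tnth_nth i) /=. by [].
- by rewrite !(tnth_nth i).
Qed.

(** The bridge from trajectories to matrices: the probabilities of events about the first state, the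
    word and the last state are computed through it. *)
Lemma sum_traj N (G : state M -> N.-tuple (symbol M) -> state M -> R) :
  \sum_(o : traj M N) traj_pr o * G (first_state o) o.2 (last_state o) =
  \sum_(w : N.-tuple (symbol M)) \sum_i \sum_j stat M i * word_mx w i j * G i w j.
Proof.
rewrite /traj -(pair_bigA _ (fun s (w : N.-tuple (symbol M)) =>
   traj_pr (M := M) (N := N) (s, w) *
   G (first_state (N:=N) (s, w)) w (last_state (N:=N) (s, w)))) /= exchange_big /=.
apply: eq_bigr => w _; rewrite sum_tuple_cons; apply: eq_bigr => i _.
under [RHS]eq_bigr do rewrite -mulrA.
rewrite -mulr_sumr -sum_path_wt mulr_sumr; apply: eq_bigr => s _.
rewrite /traj_pr /first_state /last_state /= prod_path_wt -mulrA.
congr (_ * (_ * G _ _ _)).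
by rewrite (tnth_nth i) /= -[X in nth _ _ X](size_tuple s) nth_last.
Qed.

End WordWeights.

(** * Existence, uniqueness and positivity of the stationary distribution *)

Section Stationary.
Context {R : realType} (M : edge_hmm R).
Hypothesis (hM : is_hmm M) (Mirr : irreducible_hmm M).
Implicit Types (i j k : state M) (v p : state M -> R).

Lemma trans_ge0 (x : symbol M) i j : 0 <= trans x i j.
Proof. by case: hM. Qed.

Lemma transM_ge0 i j : 0 <= transM i j.
Proof. by apply: sumr_ge0 => x _; exact: trans_ge0. Qed.

Lemma transM_row i : \sum_j transM i j = 1.
Proof. by case: hM. Qed.

Lemma sum_enum_val (T : finType) (F : T -> R) :
  \sum_(i < #|T|) F (enum_val i) = \sum_i F i.
Proof. by rewrite [RHS](reindex _ (onW_bij _ (@enum_val_bij T))). Qed.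

Definition left_inv v := forall j, \sum_i v i * transM i j = v j.

(** Rows of T sum to 1, so [T - 1] kills the all-ones column; being singular, it also kills some
    nonzero row. *)
Lemma left_inv_exists : exists2 v, left_inv v & exists i, v i != 0.
Proof.
pose A : 'M[R]_#|state M| := \matrix_(i, j) transM (enum_val i) (enum_val j).
have A1 : (A - 1%:M) *m const_mx 1 = 0 :> 'cV_ _.
  apply/matrixP => i j; rewrite mulmxBl mul1mx !mxE.
  under eq_bigr do rewrite !mxE mulr1.
  by rewrite sum_enum_val transM_row subrr.
have : kermx (A - 1%:M) != 0.
  rewrite kermx_eq0 row_free_unit; apply/negP => /mulKmx /(_ (const_mx 1 : 'cV_ _)).
  rewrite A1 mulmx0 => /matrixP; case: hM => /card_gt0P[i _] _ _.
  by move=> /(_ (enum_rank i) 0); rewrite !mxE => /eqP; rewrite eq_sym oner_eq0.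
case/rowV0Pn => u /sub_kermxP; rewrite mulmxBr mulmx1 => /eqP.
rewrite subr_eq0 => /eqP uA u0; exists (fun i => u 0 (enum_rank i)).
  move=> j; rewrite -[in RHS]uA mxE -sum_enum_val.
  by apply: eq_bigr => i _; rewrite !mxE enum_valK enum_rankK.
case/rV0Pn : u0 => i ui; exists (enum_val i); by rewrite enum_valK.
Qed.

(* The triangle inequality gives |v| <= |v| T entrywise, and both sides have
   the same total mass. *)
Lemma left_inv_abs v : left_inv v -> left_inv (fun i => `|v i|).
Proof.
move=> hv.
have le j : `|v j| <= \sum_i `|v i| * transM i j.
  rewrite -{1}hv; apply: le_trans (ler_norm_sum _ _ _) _.
  by apply: ler_sum => i _; rewrite normrM (ger0_norm (transM_ge0 i j)).
have : \sum_j (\sum_i `|v i| * transM i j - `|v j|) = 0.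
  rewrite sumrB exchange_big /= -sumrB big1 // => i _.
  by rewrite -mulr_sumr transM_row mulr1 subrr.
move/eqP; rewrite psumr_eq0 => [/allP h j|j _]; last by rewrite subr_ge0.
by apply/eqP; rewrite -subr_eq0; apply: h; rewrite mem_index_enum.
Qed.

(** Invariance carries mass along each edge, [v k >= v i * transM i k], hence along paths. *)
Lemma left_inv_gt0 v : left_inv v -> (forall i, 0 <= v i) ->
  forall i j, 0 < v i -> 0 < v j.
Proof.
move=> hv v0 i j; have /connectP[p + ->] := Mirr i j.
elim: p i => //= k p IH i /andP[ik pk] vi; apply: IH => //.
rewrite -(hv k); apply: lt_le_trans (_ : v i * transM i k <= _).
  by rewrite mulr_gt0.
rewrite (bigD1 i) //= lerDl; apply: sumr_ge0 => l _.
by rewrite mulr_ge0 ?transM_ge0.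
Qed.

(** If an invariant [u] is positive somewhere, then [|u| + u] is invariant, nonnegative and positive
    there, hence positive everywhere. This forces [u > 0] everywhere, against the zero sum. Apply
    this to [v] and [- v]. *)
Lemma left_inv_sum0 v : left_inv v -> \sum_i v i = 0 -> forall i, v i = 0.
Proof.
move=> hv v0.
have nonneg (u : state M -> R) : left_inv u -> \sum_i u i = 0 -> forall i, u i <= 0.
  move=> hu u0 i; rewrite leNgt; apply/negP => ui.
  pose w k := `|u k| + u k.
  have hw : left_inv w.
    move=> j; rewrite /w -{2}(hu j) -(left_inv_abs hu j) -big_split.
    by apply: eq_bigr => k _; rewrite mulrDl.
  have w0 k : 0 <= w k by rewrite /w -lerBlDr sub0r -normrN ler_norm.
  have wp k : 0 < w k.
    by apply: (left_inv_gt0 hw w0 (i := i)); rewrite /w addr_gt0 // normr_gt0 gt_eqF.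
  have up k : 0 < u k.
    rewrite ltNge; apply/negP => uk; have := wp k.
    by rewrite /w ler0_norm // addNr ltxx.
  have : 0 < \sum_k u k.
    by rewrite (bigD1 i) //= ltr_wpDr // sumr_ge0 // => k _; exact: ltW.
  by rewrite u0 ltxx.
move=> i; apply/eqP; rewrite eq_le nonneg //=.
rewrite -oppr_le0 (nonneg (fun k => - v k)) //.
  by move=> j; rewrite -(hv j) -sumrN; apply: eq_bigr => k _; rewrite mulNr.
by rewrite sumrN v0 oppr0.
Qed.

Lemma stationary_unique (p q : {ffun state M -> R}) :
  is_stationary p -> is_stationary q -> p = q.
Proof.
move=> [_ p1 hp] [_ q1 hq]; apply/ffunP => i; apply/eqP; rewrite -subr_eq0.
apply/eqP; apply: (@left_inv_sum0 (fun i => p i - q i)); last by rewrite sumrB p1 q1 subrr.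
by move=> j; rewrite -(hp j) -(hq j) -sumrB; apply: eq_bigr => k _; rewrite mulrBl.
Qed.

Lemma stationary_exists : exists p : {ffun state M -> R}, is_stationary p.
Proof.
have [v hv [i vi]] := left_inv_exists.
have s0 : 0 < \sum_k `|v k|.
  by rewrite (bigD1 i) //= ltr_wpDr ?normr_gt0 // sumr_ge0.
exists [ffun k => `|v k| / \sum_k `|v k|]; split => [k||j].
- by rewrite ffunE divr_ge0 // ltW.
- by under eq_bigr do rewrite ffunE; rewrite -mulr_suml divff // gt_eqF.
- under eq_bigr do rewrite ffunE mulrAC.
  by rewrite -mulr_suml left_inv_abs // ffunE.
Qed.

Lemma stat_stationary : is_stationary (stat M).
Proof. by have [p hp] := stationary_exists; exact: (xgetPex _ (ex_intro _ p hp)). Qed.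

Lemma stat_unique (p : {ffun state M -> R}) : is_stationary p -> stat M = p.
Proof. exact: stationary_unique stat_stationary. Qed.

Lemma stat_gt0 i : 0 < stat M i.
Proof.
have [p0 p1 hp] := stat_stationary.
have [j pj] : exists j, 0 < stat M j.
  apply: contrapT => h; have : \sum_j stat M j <= 0.
    by apply: sumr_le0 => j _; rewrite leNgt; apply/negP => pj; apply: h; exists j.
  by rewrite p1 ler10.
exact: left_inv_gt0 hp p0 _ _ pj.
Qed.

End Stationary.

(** * Probabilities of word events in terms of matrix products *)

Section WordEvents.
Context {R : realType} (M : edge_hmm R).
Hypothesis (hM : is_hmm M) (Mirr : irreducible_hmm M).
Implicit Types (u v w : seq (symbol M)) (i j k : state M).

Lemma word_mx_ge0 w i j : 0 <= word_mx w i j.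
Proof.
elim: w i => [|x w IH] i /=; first exact: ler0n.
by apply: sumr_ge0 => k _; rewrite mulr_ge0 ?trans_ge0.
Qed.

Lemma emit_ge0 w i : 0 <= emit w i.
Proof. by apply: sumr_ge0 => j _; exact: word_mx_ge0. Qed.

Lemma word_mx_le_emit w i j : word_mx w i j <= emit w i.
Proof.
by rewrite /emit (bigD1 j) //= lerDl sumr_ge0 // => k _; exact: word_mx_ge0.
Qed.

Lemma emit_gt0 w i : 0 < emit w i -> exists j, 0 < word_mx w i j.
Proof.
move=> wi; apply: contrapT => h; move: wi; rewrite ltNge => /negP; apply.
by apply: sumr_le0 => j _; rewrite leNgt; apply/negP => wj; apply: h; exists j.
Qed.

Lemma stat_ge0 i : 0 <= stat M i.
Proof. exact/ltW/stat_gt0. Qed.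

Lemma emit_cons x w i : emit (x :: w) i = \sum_k trans x i k * emit w k.
Proof. by rewrite -cat1s emit_cat; apply: eq_bigr => k _; rewrite word_mx1. Qed.

Lemma word_wt_ge0 w : 0 <= word_wt w.
Proof. by apply: sumr_ge0 => i _; rewrite mulr_ge0 ?stat_ge0 ?emit_ge0. Qed.

Lemma emit_eq0 w i : word_wt w = 0 -> emit w i = 0.
Proof.
move/eqP; rewrite psumr_eq0 => [/allP /(_ i)|j _]; last first.
  by rewrite mulr_ge0 ?stat_ge0 ?emit_ge0.
rewrite mem_index_enum => /(_ isT) /=.
by rewrite mulf_eq0 (gt_eqF (stat_gt0 hM Mirr i)) /= => /eqP.
Qed.

Lemma word_wt_gt0 w i : 0 < emit w i -> 0 < word_wt w.
Proof.
move=> wi; rewrite lt_def word_wt_ge0 andbT; apply/eqP => w0.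
by move: wi; rewrite emit_eq0 // ltxx.
Qed.

Lemma sum_emit n i : \sum_(w : n.-tuple (symbol M)) emit w i = 1.
Proof.
elim: n i => [|n IH] i; first by rewrite (sum_tuple0 (fun w => emit w i)) emit_nil.
rewrite (sum_tupleS n (fun w => emit w i)) -[RHS](transM_row hM i).
rewrite /transM [RHS]exchange_big /=; apply: eq_bigr => x _.
under eq_bigr do rewrite emit_cons.
rewrite exchange_big /=; apply: eq_bigr => k _.
by rewrite -mulr_sumr IH mulr1.
Qed.

Lemma sum_word_wt n : \sum_(w : n.-tuple (symbol M)) word_wt w = 1.
Proof.
rewrite /word_wt exchange_big /=; have [_ <- _] := stat_stationary hM.
by apply: eq_bigr => i _; rewrite -mulr_sumr sum_emit mulr1.
Qed.

(** Stationarity: summing out the first symbol applies T to the stationary law. This is what allows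
    the process to be read backwards. *)
Lemma sum_word_wt_cons w : \sum_x word_wt (x :: w) = word_wt w.
Proof.
rewrite /word_wt exchange_big /=.
under eq_bigr do rewrite -mulr_sumr.
transitivity (\sum_i \sum_k stat M i * transM i k * emit w k).
  apply: eq_bigr => i _; under eq_bigr do rewrite emit_cons.
  rewrite exchange_big /= mulr_sumr; apply: eq_bigr => k _.
  by rewrite -mulr_suml mulrA.
rewrite exchange_big /=; apply: eq_bigr => k _; rewrite -mulr_suml.
by have [_ _ ->] := stat_stationary hM.
Qed.

Lemma sum_word_wt_cat n w : \sum_(u : n.-tuple (symbol M)) word_wt (u ++ w) = word_wt w.
Proof.
elim: n => [|n IH]; first by rewrite (sum_tuple0 (fun u => word_wt (u ++ w))).
rewrite (sum_tupleS n (fun u => word_wt (u ++ w))) exchange_big /= -[RHS]IH.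
by apply: eq_bigr => u _; rewrite sum_word_wt_cons.
Qed.

Lemma sum_emit_rcons w i : \sum_x emit (rcons w x) i = emit w i.
Proof.
under eq_bigr do rewrite -cats1 emit_cat.
rewrite exchange_big /=; apply: eq_bigr => k _.
(* The sum over one symbol is turned into a sum over words of length 1, where [sum_emit] applies. *)
by rewrite -mulr_sumr -(sum_tuple0 (fun u => \sum_x emit (x :: u) k)) exchange_big
  -(sum_tupleS 0 (fun u => emit u k)) sum_emit mulr1.
Qed.

Lemma sum_word_wt_rcons w : \sum_x word_wt (rcons w x) = word_wt w.
Proof.
rewrite /word_wt exchange_big /=; apply: eq_bigr => i _.
by rewrite -mulr_sumr sum_emit_rcons.
Qed.

Lemma Pr_word N (A : pred (N.-tuple (symbol M))) :
  Pr [pred o : traj M N | A o.2] = \sum_(w | A w) word_wt w.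
Proof.
rewrite /Pr big_mkcond /=.
rewrite (eq_bigr (fun o => traj_pr o * (A o.2)%:R)); last first.
  by move=> o _; case: (A _); rewrite ?mulr1 ?mulr0.
rewrite (sum_traj (fun _ (w : N.-tuple _) _ => (A w)%:R)) [RHS]big_mkcond.
apply: eq_bigr => w _; rewrite /word_wt; case: (A w); last first.
  by rewrite big1 // => i _; rewrite big1 // => j _; rewrite mulr0.
by apply: eq_bigr => i _; rewrite /emit mulr_sumr; apply: eq_bigr => j _; rewrite mulr1.
Qed.

Lemma Pr_traj N (A : state M -> N.-tuple (symbol M) -> state M -> bool) :
  Pr [pred o : traj M N | A (first_state o) o.2 (last_state o)] =
  \sum_(w : N.-tuple (symbol M)) \sum_i \sum_j stat M i * word_mx w i j * (A i w j)%:R.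
Proof.
rewrite /Pr big_mkcond /= -(sum_traj (fun i (w : N.-tuple _) j => (A i w j)%:R)).
by apply: eq_bigr => o _; case: (A _); rewrite ?mulr1 ?mulr0.
Qed.

Lemma word_prE n (w : n.-tuple (symbol M)) : word_pr w = word_wt w.
Proof. by rewrite /word_pr (Pr_word (pred1 w)) big_pred1_eq. Qed.

Lemma Pr_first n i : Pr [pred o : traj M n | first_state o == i] = stat M i.
Proof.
rewrite (Pr_traj (fun k _ _ => k == i)) exchange_big /= (bigD1 i) //=.
rewrite [X in _ + X]big1 ?addr0.
  rewrite eqxx -[RHS]mulr1 -[X in _ = _ * X](sum_emit n i) mulr_sumr.
  apply: eq_bigr => w _.
  by rewrite mulr_sumr; apply: eq_bigr => j _; rewrite mulr1.
move=> k /negPf ki; rewrite big1 // => w _; rewrite big1 // => j _.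
by rewrite ki mulr0.
Qed.

Lemma Pr_from_word n i (A : n.-tuple (symbol M) -> state M -> bool) :
  Pr_from i [pred o : traj M n | A o.2 (last_state o)] =
  \sum_(w : n.-tuple (symbol M)) \sum_j word_mx w i j * (A w j)%:R.
Proof.
rewrite /Pr_from /condPr Pr_first.
rewrite (Pr_traj (fun k (w : n.-tuple _) j => A w j && (k == i))) mulr_suml.
apply: eq_bigr => w _.
rewrite (bigD1 i) //= [X in _ + X]big1 ?addr0.
  rewrite mulr_suml; apply: eq_bigr => j _; rewrite eqxx andbT.
  by rewrite -[stat M i * _ * _]mulrA mulrC mulKf // gt_eqF // stat_gt0.
by move=> k /negPf ki; rewrite big1 // => j _; rewrite ki andbF mulr0.
Qed.

Lemma word_pr_fromE n i (w : n.-tuple (symbol M)) : word_pr_from i w = emit w i.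
Proof.
rewrite /word_pr_from (Pr_from_word i (fun (u : n.-tuple _) _ => u == w)).
rewrite (bigD1 w) //= [X in _ + X]big1 ?addr0.
  by rewrite eqxx; apply: eq_bigr => j _; rewrite mulr1.
by move=> u /negPf uw; rewrite big1 // => j _; rewrite uw mulr0.
Qed.

Lemma word_end_prE n i (w : n.-tuple (symbol M)) j : word_end_pr i w j = word_mx w i j.
Proof.
rewrite /word_end_pr (Pr_from_word i (fun (u : n.-tuple _) k => (u == w) && (k == j))).
rewrite (bigD1 w) //= [X in _ + X]big1 ?addr0.
  rewrite (bigD1 j) //= !eqxx mulr1 [X in _ + X]big1 ?addr0 // => k /negPf kj.
  by rewrite kj andbF mulr0.
by move=> u /negPf uw; rewrite big1 // => k _; rewrite uw mulr0.
Qed.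

Lemma mem_delta w i j : (j \in delta i w) = (0 < word_mx w i j).
Proof. by rewrite inE word_end_prE. Qed.

Lemma delta_neq0 w i : (delta i w != finset.set0) = (0 < emit w i).
Proof.
apply/set0Pn/idP => [[j]|/emit_gt0[j wj]]; last by exists j; rewrite mem_delta.
by rewrite mem_delta => wj; apply: lt_le_trans wj (word_mx_le_emit _ _ _).
Qed.

End WordEvents.

(** Version of [sum_tupleSr] for summands on tuples, needed for events stated with [tnth]. *)
Lemma sum_tuple_rcons {R : realType} {T : finType} n (F : n.+1.-tuple T -> R) :
  \sum_(w : n.+1.-tuple T) F w =
  \sum_(w : n.-tuple T) \sum_x F [tuple of rcons w x].
Proof.
rewrite pair_bigA /= (reindex (fun p : n.-tuple T * T => [tuple of rcons p.1 p.2])) //=.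
apply: onW_bij; apply: inj_card_bij => [[u x] [v y] /= /(congr1 val)|].
  by move=> /rcons_inj[/val_inj -> ->].
by rewrite card_prod !card_tuple expnSr.
Qed.

(** * Block entropies, their increments and the estimates [h(t)] *)

Section Entropy.
Context {R : realType} (M : edge_hmm R).
Hypothesis (hM : is_hmm M) (Mirr : irreducible_hmm M).
Implicit Types (u v w : seq (symbol M)) (x y : symbol M).

Definition word_entropy t : R :=
  - \sum_(w : t.-tuple (symbol M)) word_wt w * log2 (word_wt w).

(** By the chain rule this is [h(t+1)]; note the shift of index. *)
Definition entropy_incr t : R := word_entropy t.+1 - word_entropy t.

(** The entropies start at X_1, so the leading symbol [x] of the trajectory is X_0 and is
    skipped. *)
Lemma word_at_cons t x (w : t.-tuple (symbol M)) :
  [tuple tnth [tuple of x :: w] (inord (1 + i)) | i < t] = w.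
Proof.
apply: eq_from_tnth => i; rewrite tnth_mktuple.
rewrite (_ : inord _ = lift ord0 i) ?tnthS //.
by apply/val_inj; rewrite /= inordK // ltnS.
Qed.

Lemma word_at_cons_rcons t x (w : t.-tuple (symbol M)) y :
  [tuple tnth [tuple of x :: [tuple of rcons w y]] (inord (1 + i)) | i < t] = w.
Proof.
apply: eq_from_tnth => i; rewrite tnth_mktuple.
rewrite (_ : inord _ = lift ord0 (widen_ord (leqnSn t) i)).
  by rewrite tnthS !(tnth_nth x) /= nth_rcons size_tuple ltn_ord.
apply/val_inj; rewrite /= inordK // ltnS.
by apply: ltn_trans (ltn_ord i) _.
Qed.

Lemma block_entropyE t : block_entropy M t = word_entropy t.
Proof.
rewrite /block_entropy /entropy /word_entropy; congr (- _); apply: eq_bigr => a _.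
suff -> : Pr [pred o : traj M t.+1 | word_at 1 t o == a] = word_wt a by [].
apply: etrans (Pr_word (fun w : t.+1.-tuple _ =>
  [tuple tnth w (inord (1 + i)) | i < t] == a)) _.
rewrite big_mkcond sum_tuple_cons -(sum_word_wt_cons hM a).
apply: eq_bigr => x _; under eq_bigr do rewrite word_at_cons.
by rewrite -big_mkcond big_pred1_eq.
Qed.

(** Joint law of X_1^t and the next symbol; X_0 is summed out by stationarity. *)
Lemma Pr_word_symbol t (A : t.-tuple (symbol M) -> symbol M -> bool) :
  Pr [pred o : traj M t.+2 | A (word_at 1 t o) (tnth o.2 ord_max)] =
  \sum_w \sum_(x | A w x) word_wt (rcons w x).
Proof.
apply: etrans (Pr_word (fun w : t.+2.-tuple _ =>
  A [tuple tnth w (inord (1 + i)) | i < t] (tnth w ord_max))) _.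
rewrite big_mkcond sum_tuple_cons.
transitivity (\sum_x \sum_(w : t.-tuple (symbol M)) \sum_y
    if A w y then word_wt (x :: rcons w y) else 0).
  apply: eq_bigr => x _; rewrite sum_tuple_rcons; apply: eq_bigr => w _.
  apply: eq_bigr => y _; rewrite word_at_cons_rcons.
  by rewrite (tnth_nth x) /= nth_rcons size_tuple ltnn eqxx.
rewrite exchange_big /=; apply: eq_bigr => w _.
rewrite exchange_big [RHS]big_mkcond /=; apply: eq_bigr => y _.
case: (A w y); last by rewrite big1.
by rewrite (sum_word_wt_cons hM).
Qed.

Lemma word_wt_rcons_le w x : word_wt (rcons w x) <= word_wt w.
Proof.
rewrite -(sum_word_wt_rcons hM w) (bigD1 x) //= lerDl.
by apply: sumr_ge0 => y _; exact: word_wt_ge0.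
Qed.

Lemma word_wt_cat_le u w : word_wt (u ++ w) <= word_wt w.
Proof.
rewrite -(sum_word_wt_cat hM (size u) w) (bigD1 (in_tuple u)) //= lerDl.
by apply: sumr_ge0 => v _; exact: word_wt_ge0.
Qed.

Lemma entropy_incrE t : entropy_incr t =
  - \sum_(w : t.-tuple (symbol M)) \sum_x
      word_wt (rcons w x) * (log2 (word_wt (rcons w x)) - log2 (word_wt w)).
Proof.
rewrite /entropy_incr /word_entropy.
rewrite (sum_tupleSr t (fun w => word_wt w * log2 (word_wt w))).
rewrite -opprD -sumrB; congr (- _); apply: eq_bigr => w _.
rewrite -[in LHS](sum_word_wt_rcons hM w) mulr_suml -sumrB.
by apply: eq_bigr => x _; rewrite mulrBr sum_word_wt_rcons.
Qed.

Lemma entropy_estimateE t : entropy_estimate M t.+1 = entropy_incr t.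
Proof.
rewrite entropy_incrE /entropy_estimate /cond_entropy -sumrN; apply: eq_bigr => w _ /=.
have Pw : Pr [pred o : traj M t.+2 | word_at 1 t o == w] = word_wt w.
  rewrite (Pr_word_symbol (fun (v : t.-tuple _) _ => v == w)) -(sum_word_wt_rcons hM w).
  rewrite (bigD1 w) //= eqxx [X in _ + X]big1 ?addr0 // => v /negPf ->.
  by rewrite big_pred0.
rewrite Pw.
rewrite mulrN mulr_sumr; congr (- _); apply: eq_bigr => x _; rewrite /condPr.
have -> : Pr [pred o : traj M t.+2 | [pred o | tnth o.2 ord_max == x] o
   && [pred o | word_at 1 t o == w] o] = word_wt (rcons w x).
  rewrite (Pr_word_symbol (fun (v : t.-tuple _) y => (y == x) && (v == w))).
  rewrite (bigD1 w) //= eqxx [X in _ + X]big1 ?addr0; last first.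
    by move=> v /negPf ->; rewrite big_pred0 // => y; rewrite andbF.
  by under eq_bigl do rewrite andbT; rewrite big_pred1_eq.
rewrite Pw.
(* A continuation of probability 0 contributes 0 on both sides; otherwise all denominators are
   positive. *)
have := word_wt_rcons_le w x; have := word_wt_ge0 hM Mirr (rcons w x).
rewrite le_eqVlt => /orP[/eqP <- _|p0 le]; first by rewrite !mul0r mulr0.
have w0 := lt_le_trans p0 le.
rewrite mulrA [X in X * _ = _]mulrC divfK ?gt_eqF //.
by rewrite /log2 ln_div ?posrE // mulrBl.
Qed.

End Entropy.

(** * Monotonicity of the increments, their limit, and a bound on their distance to it *)

Section EntropyLimit.
Context {R : realType} (M : edge_hmm R).
Hypothesis (hM : is_hmm M) (Mirr : irreducible_hmm M).
Implicit Types (u v w : seq (symbol M)) (x y : symbol M).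

Lemma ln2_gt0 : 0 < ln 2 :> R.
Proof. by rewrite ln_gt0 // ltr1n. Qed.

Lemma ln_le_subr1 (z : R) : 0 < z -> ln z <= z - 1.
Proof.
move=> z0; rewrite -{1}(subrK 1 z) addrC le_ln1Dx //.
by rewrite ltrBrDr addNr.
Qed.

(* The four weights are those of u w x, u w, w x and w. *)
Lemma log2_ratio_bounds (A B C D : R) :
    0 <= A -> A <= B -> A <= C -> C <= D -> B <= D ->
  A - B * (C / D) <= ln 2 * (A * (log2 A - log2 B - (log2 C - log2 D)))
    <= A * (D / C * (A / B - C / D)).
Proof.
rewrite le_eqVlt => /orP[/eqP <- B0 C0 CD BD|A0 AB AC CD BD].
  rewrite !mul0r mulr0 lexx andbT sub0r oppr_le0 mulr_ge0 // divr_ge0 //.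
  exact: le_trans CD.
have B0 := lt_le_trans A0 AB; have C0 := lt_le_trans A0 AC.
have D0 := lt_le_trans C0 CD.
have -> : ln 2 * (A * (log2 A - log2 B - (log2 C - log2 D))) =
    A * (ln A - ln B - (ln C - ln D)).
  by rewrite /log2; field; rewrite gt_eqF ?ln2_gt0.
rewrite -!ln_div ?posrE ?divr_gt0 //.
(* Both bounds are [ln z <= z - 1]: the lower one at [z = (C / D) / (A / B)], the upper one at its
   inverse. *)
have -> : A - B * (C / D) = A * - (C / D / (A / B) - 1).
  by field; rewrite !gt_eqF.
have -> : D / C * (A / B - C / D) = A / B / (C / D) - 1.
  by field; rewrite !gt_eqF.
rewrite !ler_pM2l // ln_le_subr1 ?divr_gt0 // andbT.
rewrite lerNl -lnV ?posrE ?divr_gt0 // invf_div.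
by apply: ln_le_subr1; rewrite !divr_gt0.
Qed.

(** The longer past extends [w] at the front by [u]; the difference is the conditional mutual
    information of [u] and the next symbol [x] given [w]. *)
Lemma entropy_incr_diff k t :
  entropy_incr M t - entropy_incr M (k + t) =
  \sum_(w : t.-tuple (symbol M)) \sum_x \sum_(u : k.-tuple (symbol M))
    word_wt (u ++ rcons w x) *
    (log2 (word_wt (u ++ rcons w x)) - log2 (word_wt (u ++ w))
       - (log2 (word_wt (rcons w x)) - log2 (word_wt w))).
Proof.
rewrite !(entropy_incrE hM) opprK addrC.
rewrite (sum_tupleD k t (fun w => \sum_x word_wt (rcons w x) *
   (log2 (word_wt (rcons w x)) - log2 (word_wt w)))).
rewrite exchange_big -sumrB; apply: eq_bigr => w _ /=.
rewrite exchange_big -sumrB; apply: eq_bigr => x _ /=.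
rewrite -[X in X * _](sum_word_wt_cat hM k (rcons w x)) mulr_suml -sumrB.
by apply: eq_bigr => u _; rewrite rcons_cat !mulrBr.
Qed.

(** Summed over [u], the lower bound of [log2_ratio_bounds] becomes [C - D * (C / D)], which is
    nonnegative also when [D = 0]. *)
Lemma entropy_incr_noninc k t : entropy_incr M (k + t) <= entropy_incr M t.
Proof.
rewrite -subr_ge0 entropy_incr_diff; apply: sumr_ge0 => w _; apply: sumr_ge0 => x _.
rewrite -(pmulr_rge0 _ ln2_gt0) mulr_sumr.
set C := word_wt (rcons w x); set D := word_wt w.
apply: le_trans (_ : \sum_(u : k.-tuple (symbol M))
    (word_wt (u ++ rcons w x) - word_wt (u ++ w) * (C / D)) <= _); last first.
  apply: ler_sum => u _.
  set A := word_wt (u ++ rcons w x); set B := word_wt (u ++ w).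
  have A0 : 0 <= A by exact: word_wt_ge0.
  have AB : A <= B by rewrite /A -rcons_cat word_wt_rcons_le.
  have AC : A <= C by exact: word_wt_cat_le.
  have CD : C <= D by exact: word_wt_rcons_le.
  have BD : B <= D by exact: word_wt_cat_le.
  by have /andP[] := log2_ratio_bounds A0 AB AC CD BD.
rewrite sumrB -mulr_suml !(sum_word_wt_cat hM) -/C -/D.
have : C <= D by exact: word_wt_rcons_le.
have : 0 <= D by exact: word_wt_ge0.
rewrite le_eqVlt => /orP[/eqP <-|D0 _].
  by rewrite invr0 !mulr0 subr0 /C word_wt_ge0.
by rewrite mulrCA divff ?gt_eqF // mulr1 subrr.
Qed.

Lemma entropy_incr_ge0 t : 0 <= entropy_incr M t.
Proof.
rewrite (entropy_incrE hM) oppr_ge0; apply: sumr_le0 => w _; apply: sumr_le0 => x _.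
have := word_wt_rcons_le hM Mirr w x; have := word_wt_ge0 hM Mirr (rcons w x).
rewrite le_eqVlt => /orP[/eqP <-|p0 le]; first by rewrite mul0r.
rewrite mulr_ge0_le0 //; first exact: ltW.
rewrite subr_le0 /log2 ler_pM2r ?invr_gt0 ?ln2_gt0 //.
by rewrite ler_ln // posrE; exact: lt_le_trans le.
Qed.

(** The hypothesis is P(x | uw) - P(x | w) <= d(w), cross-multiplied to allow null words. In the
    upper bound of [log2_ratio_bounds] the sum over [u] cancels [C], leaving at most
    [word_wt w * d w] for each symbol [x]; hence the factor [#|symbol M|]. *)
Lemma entropy_incr_le k t (d : seq (symbol M) -> R) :
    (forall w u x, size w = t -> 0 <= d w /\
       word_wt (u ++ rcons w x) * word_wt w - word_wt (rcons w x) * word_wt (u ++ w)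
         <= d w * (word_wt (u ++ w) * word_wt w)) ->
  entropy_incr M t - entropy_incr M (k + t) <=
    #|symbol M|%:R / ln 2 * \sum_(w : t.-tuple (symbol M)) word_wt w * d w.
Proof.
move=> hd; rewrite entropy_incr_diff mulrAC ler_pdivlMr ?ln2_gt0 // mulrC mulr_sumr.
rewrite mulr_sumr; apply: ler_sum => w _.
rewrite mulr_sumr -[#|symbol M|]/(#|xpredT|) mulr_natl -sumr_const.
apply: ler_sum => x _.
have [d0 _] := hd w [::] x (size_tuple w).
rewrite mulr_sumr.
set C := word_wt (rcons w x); set D := word_wt w.
have C0 : 0 <= C by exact: word_wt_ge0.
have D0 : 0 <= D by exact: word_wt_ge0.
apply: le_trans (_ : \sum_(u : k.-tuple (symbol M))
    (word_wt (u ++ rcons w x) * (D / C * d w)) <= _).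
  apply: ler_sum => u _.
  set A := word_wt (u ++ rcons w x); set B := word_wt (u ++ w).
  have A0 : 0 <= A by exact: word_wt_ge0.
  have AB : A <= B by rewrite /A -rcons_cat word_wt_rcons_le.
  have AC : A <= C by exact: word_wt_cat_le.
  have CD : C <= D by exact: word_wt_rcons_le.
  have BD : B <= D by exact: word_wt_cat_le.
  have /andP[_ h] := log2_ratio_bounds A0 AB AC CD BD; apply: le_trans h _.
  move: A0; rewrite le_eqVlt => /orP[/eqP <-|A0]; first by rewrite !mul0r.
  have B0 := lt_le_trans A0 AB; have C1 := lt_le_trans A0 AC.
  have D1 := lt_le_trans C1 CD.
  rewrite ler_pM2l // ler_pM2l ?divr_gt0 //.
  have [_] := hd w u x (size_tuple w); rewrite -/A -/B -/C -/D.
  rewrite -ler_pdivrMr ?mulr_gt0 //; congr (_ <= _).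
  by field; rewrite !gt_eqF.
rewrite -mulr_suml (sum_word_wt_cat hM) -/C.
have [->|C1] := eqVneq C 0; first by rewrite mul0r mulr_ge0.
by rewrite mulrA mulrCA divff // mulr1.
Qed.

Lemma entropy_incr_is_cvg : cvgn (entropy_incr M).
Proof.
apply: nonincreasing_is_cvgn.
  by move=> m n /subnK <-; exact: entropy_incr_noninc.
by exists 0 => _ [n _ <-]; exact: entropy_incr_ge0.
Qed.

(** The empty block has entropy 0, so [H(X_1^t) / t] is the mean of the first [t] increments, and
    Cesaro applies. *)
Lemma entropy_rateE : entropy_rate M = limn (entropy_incr M).
Proof.
apply/cvg_lim => //; rewrite -cvg_shiftS.
have := cesaro entropy_incr_is_cvg; apply: cvg_trans; apply: near_eq_cvg.
apply: nearW => n; rewrite /arithmetic_mean /= (block_entropyE hM) mulrC; congr (_ * _).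
rewrite /series /= /entropy_incr telescope_sumr // {2}/word_entropy.
rewrite (sum_tuple0 (fun w => word_wt w * log2 (word_wt w))).
rewrite -[word_wt _](sum_tuple0 (@word_wt R M)) (sum_word_wt hM) /log2 ln1.
by rewrite mul0r mulr0 oppr0 subr0.
Qed.

Lemma entropy_rate_le t : entropy_rate M <= entropy_incr M t.
Proof.
rewrite entropy_rateE; apply: nonincreasing_cvgn_ge; last exact: entropy_incr_is_cvg.
by move=> m n /subnK <-; exact: entropy_incr_noninc.
Qed.

Lemma entropy_incr_sub_rate_le t b :
  (forall k, entropy_incr M t - entropy_incr M (k + t) <= b) ->
  entropy_incr M t - entropy_rate M <= b.
Proof.
move=> h; rewrite lerBlDr -lerBlDl entropy_rateE.
apply: limr_ge; first exact: entropy_incr_is_cvg.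
near=> n; have /subnK <- : (t <= n)%N by near: n; exists t.
by rewrite lerBlDl -lerBlDr.
Unshelve. all: by end_near. Qed.

End EntropyLimit.

(* The diagonal term at [j] contributes nothing to the left-hand side: two
   mixtures sharing mass at [j] are closer than their components. *)
Lemma cross_sum_le {R : realType} {S : finType} (a b al be : S -> R) (d : R) (j : S) :
    (forall i, 0 <= al i) -> (forall i, 0 <= be i) ->
    (forall i k, b i * a k - b k * a i <= d * (a i * a k)) ->
  (\sum_i al i * b i) * (\sum_i be i * a i) - (\sum_i be i * b i) * (\sum_i al i * a i)
  <= d * ((\sum_i al i * a i) * (\sum_i be i * a i) - al j * a j * (be j * a j)).
Proof.
move=> al0 be0 h.
have mulS (f g : S -> R) : (\sum_i f i) * (\sum_k g k) = \sum_i \sum_k f i * g k.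
  by rewrite mulr_suml; apply: eq_bigr => i _; rewrite mulr_sumr.
have -> : al j * a j * (be j * a j) =
    \sum_i \sum_k (if (i == j) && (k == j) then al i * a i * (be k * a k) else 0).
  rewrite (bigD1 j) //= [X in _ + X]big1 ?addr0; last first.
    by move=> i /negPf ->; rewrite big1.
  rewrite (bigD1 j) //= !eqxx [X in _ + X]big1 ?addr0 // => k /negPf ->.
  by rewrite andbF.
rewrite [X in _ - X]mulrC !mulS -!sumrB mulr_sumr; apply: ler_sum => i _.
rewrite -!sumrB mulr_sumr; apply: ler_sum => k _.
have -> : al i * b i * (be k * a k) - al i * a i * (be k * b k) =
    al i * be k * (b i * a k - b k * a i) by ring.
case: ifPn => [/andP[/eqP -> /eqP ->]|_]; first by rewrite !subrr !mulr0.
rewrite subr0 (_ : d * _ = al i * be k * (d * (a i * a k))); last by ring.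
by rewrite ler_wpM2l ?mulr_ge0.
Qed.

(** * Contraction of predictions along flag words, read backwards *)

Section Contraction.
Context {R : realType} (M : edge_hmm R).
Hypothesis (hM : is_hmm M) (Mirr : irreducible_hmm M).
Variables (n : nat) (y : state M -> n.-tuple (symbol M)) (p q r : R) (s0 : state M).
Hypotheses (q0 : 0 <= q <= 1) (p0 : 0 <= p) (r0 : 0 <= r).
(** What the minima q_*, p_*, r_* of the block model provide, in terms of [M] itself; see
    [q_star_le], [p_star_le] and [r_star_le]. *)
Hypothesis y_q : forall i j, q * emit (y j) i <= word_mx (y j) i j.
Hypothesis y_p : forall j, p * stat M j <= \sum_i stat M i * word_mx (y j) i j.
Hypothesis y_r : forall i j, r * stat M j <= stat M i.
Implicit Types (u v w : seq (symbol M)) (i j k : state M).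

Let c := p * r / #|state M|%:R.

Definition likeliest w : state M := [arg max_(j > s0) emit w j]%O.

Lemma likeliestP w k : emit w k <= emit w (likeliest w).
Proof. by rewrite /likeliest; case: arg_maxP => // i _; apply. Qed.

(** The closeness delta guaranteed for [w] by its first [m] blocks: a factor [1 - q ^+ 2] for each
    block that is the flag word of the state likeliest to emit what follows it. *)
Fixpoint discount m w : R :=
  if m is m'.+1 then
    (if take n w == y (likeliest (drop n w)) then 1 - q ^+ 2 else 1) *
    discount m' (drop n w)
  else 1.

Lemma q2_le1 : 0 <= 1 - q ^+ 2.
Proof. by case/andP: q0 => q1 q2; rewrite subr_ge0 expr_le1. Qed.

Lemma discount_ge0 m w : 0 <= discount m w.
Proof.
elim: m w => [|m IH] w //=; rewrite mulr_ge0 //.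
by case: ifP => _ //; exact: q2_le1.
Qed.

Lemma emit_rcons_le w x i : emit (rcons w x) i <= emit w i.
Proof.
rewrite -(sum_emit_rcons hM w i) (bigD1 x) //= lerDl.
by apply: sumr_ge0 => z _; exact: emit_ge0.
Qed.

(** Predictions of [x] from [i] and [k], compared without division. With [w = u ++ v], both are
    mixtures over the state after [u], so [cross_sum_le] applies to the bound for [v]. *)
Lemma discount_contracts m w x i k :
  emit (rcons w x) i * emit w k - emit (rcons w x) k * emit w i
    <= discount m w * (emit w i * emit w k).
Proof.
elim: m w i k => [|m IH] w i k /=.
  rewrite mul1r lerBlDr (le_trans (y := emit w i * emit w k)) //.
    by rewrite ler_wpM2r ?emit_ge0 // emit_rcons_le.
  by rewrite lerDl mulr_ge0 ?emit_ge0.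
set v := drop n w; set u := take n w; set j := likeliest v.
have vE l : emit (rcons w x) l = \sum_h word_mx u l h * emit (rcons v x) h.
  by rewrite -{1}(cat_take_drop n w) rcons_cat emit_cat.
have wE l : emit w l = \sum_h word_mx u l h * emit v h.
  by rewrite -{1}(cat_take_drop n w) emit_cat.
have := @cross_sum_le _ _ (emit v) (emit (rcons v x)) (word_mx u i) (word_mx u k)
  (discount m v) j (word_mx_ge0 hM u i) (word_mx_ge0 hM u k) (IH v).
rewrite -!vE -!wE => h; apply: le_trans h _.
rewrite [X in _ <= X * _]mulrC -[leRHS]mulrA.
apply: ler_wpM2l; first exact: discount_ge0.
case: eqP => [uy|_]; last first.
  by rewrite mul1r gerBl !mulr_ge0 ?word_mx_ge0 ?emit_ge0.
(* On a flag block a share [q] of the weight of [u] ends in [j], and no state emits [v] more likely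
   than [j]; so from any start at least a share [q] of the weight of [w] passes through [j]. *)
have jm l : q * emit w l <= word_mx u l j * emit v j.
  apply: le_trans (_ : q * emit u l * emit v j <= _); last first.
    by rewrite ler_wpM2r ?emit_ge0 // uy y_q.
  rewrite -mulrA ler_wpM2l //; first by case/andP: q0.
  rewrite wE mulr_suml; apply: ler_sum => h _.
  by rewrite ler_wpM2l ?word_mx_ge0 // likeliestP.
rewrite mulrBl mul1r lerD2l lerN2 expr2 mulrACA ler_pM //.
  by rewrite mulr_ge0 ?emit_ge0 //; case/andP: q0.
by rewrite mulr_ge0 ?emit_ge0 //; case/andP: q0.
Qed.

Lemma word_wt_cat u w :
  word_wt (u ++ w) = \sum_k (\sum_i stat M i * word_mx u i k) * emit w k.
Proof.
rewrite /word_wt; under eq_bigr do rewrite emit_cat mulr_sumr.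
rewrite exchange_big /=; apply: eq_bigr => k _.
by rewrite mulr_suml; apply: eq_bigr => i _; rewrite mulrA.
Qed.

(** The state before [w] has law [stat M], or weights [al] when [u] precedes it. Both are mixtures
    of starting states, so the bound from single states carries over; the gain at [s0] is
    dropped. *)
Lemma discount_word_wt m u w x :
  word_wt (u ++ rcons w x) * word_wt w - word_wt (rcons w x) * word_wt (u ++ w)
    <= discount m w * (word_wt (u ++ w) * word_wt w).
Proof.
rewrite !word_wt_cat.
pose al k := \sum_i stat M i * word_mx u i k.
have al0 k : 0 <= al k.
  by apply: sumr_ge0 => i _; rewrite mulr_ge0 ?stat_ge0 ?word_mx_ge0.
have := @cross_sum_le _ _ (emit w) (emit (rcons w x)) al (stat M) (discount m w) s0
  al0 (stat_ge0 hM Mirr) (discount_contracts m w x).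
move=> /le_trans; apply; apply: ler_wpM2l; first exact: discount_ge0.
by rewrite gerBl !mulr_ge0 ?emit_ge0 ?stat_ge0.
Qed.

Lemma card_gt0 : (0 : R) < #|state M|%:R.
Proof. by case: hM => h _ _; rewrite ltr0n. Qed.

(** With [j] likeliest, each term of [word_wt w] satisfies [r * (stat M k * emit w k) <= stat M j *
    emit w j]; and [y j] followed by [w] through [j] weighs at least [p * (stat M j * emit w j)]. *)
Lemma flag_word_freq w : c * word_wt w <= word_wt (y (likeliest w) ++ w).
Proof.
set j := likeliest w.
apply: le_trans (_ : p * (stat M j * emit w j) <= _); last first.
  rewrite mulrA word_wt_cat (bigD1 j) //=.
  rewrite -[X in X <= _]addr0 lerD ?ler_wpM2r ?emit_ge0 ?y_p //.
  apply: sumr_ge0 => k _; rewrite mulr_ge0 ?emit_ge0 // sumr_ge0 // => i _.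
  by rewrite mulr_ge0 ?stat_ge0 ?word_mx_ge0.
rewrite /c -!mulrA ler_wpM2l // mulrC -mulrA mulrC ler_pdivrMr ?card_gt0 //.
rewrite mulrC mulr_sumr -[#|state M|]/(#|xpredT|) mulr_natr -sumr_const.
apply: ler_sum => k _.
by rewrite mulrA ler_pM ?mulr_ge0 ?emit_ge0 ?stat_ge0 // likeliestP.
Qed.

(** Average over the leftmost block with the rest [w] fixed: it is the flag word with conditional
    weight at least [c], so its factor has mean at most [1 - c * q ^+ 2]. The [l] leftover symbols
    at the right end are not matched against flag words. *)
Lemma sum_discount m l :
  0 <= 1 - c * q ^+ 2 ->
  \sum_(w : (m * n + l).-tuple (symbol M)) word_wt w * discount m w
    <= (1 - c * q ^+ 2) ^+ m.
Proof.
move=> cq; elim: m => [|m IH].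
  by rewrite expr0 -(sum_word_wt hM l) add0n; apply: ler_sum => w _; rewrite mulr1.
rewrite mulSn -addnA (sum_tupleD n (m * n + l) (fun w => word_wt w * discount m.+1 w)).
rewrite exchange_big /= [leRHS]exprS.
apply: le_trans (ler_wpM2l cq IH); rewrite [leRHS]mulr_sumr; apply: ler_sum => w _.
have -> : \sum_(u : n.-tuple (symbol M)) word_wt (u ++ w) *
    ((if take n (u ++ w) == y (likeliest (drop n (u ++ w))) then 1 - q ^+ 2 else 1) *
     discount m (drop n (u ++ w))) =
    discount m w * (word_wt w - q ^+ 2 * word_wt (y (likeliest w) ++ w)).
  have -> : q ^+ 2 * word_wt (y (likeliest w) ++ w) =
      \sum_(u : n.-tuple (symbol M))
        if u == y (likeliest w) then q ^+ 2 * word_wt (u ++ w) else 0.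
    by rewrite -big_mkcond big_pred1_eq.
  rewrite -(sum_word_wt_cat hM n w) -sumrB mulr_sumr; apply: eq_bigr => u _.
  rewrite take_size_cat ?size_tuple // drop_size_cat ?size_tuple //.
  by rewrite (val_eqE u (y _)); case: ifP => _; ring.
rewrite (_ : (1 - c * q ^+ 2) * _ =
  discount m w * (word_wt w - q ^+ 2 * (c * word_wt w))); last by ring.
rewrite ler_wpM2l ?discount_ge0 // lerD2l lerN2.
by rewrite ler_wpM2l ?sqr_ge0 // flag_word_freq.
Qed.

Lemma entropy_incr_rate_bound m l :
  0 <= 1 - c * q ^+ 2 ->
  entropy_incr M (m * n + l) - entropy_rate M <=
    #|symbol M|%:R / ln 2 * (1 - c * q ^+ 2) ^+ m.
Proof.
move=> cq; apply: entropy_incr_sub_rate_le => // k.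
apply: le_trans (_ : _ <= #|symbol M|%:R / ln 2 *
   \sum_(w : (m * n + l).-tuple (symbol M)) word_wt w * discount m w) _.
  apply: entropy_incr_le => // w u x _; split; first exact: discount_ge0.
  exact: discount_word_wt.
by apply: ler_wpM2l; [rewrite divr_ge0 // ltW // ln2_gt0|exact: sum_discount].
Qed.

End Contraction.

(** * Elementary inequalities for the rate, and limsups of roots *)

Section Rates.
Context {R : realType}.

(* For small [x], [1 - x >= exp (- 2 x)] makes the second term dominate;
   otherwise [exp (- z) >= 1 - z] makes the first one dominate. *)
Lemma one_sub_mul_le_max (c x : R) : 0 < c <= 1 -> 0 < x <= 1 ->
  1 - c * x <= Order.max (expR (- (c ^+ 2 / 2))) ((1 - x) `^ (c / 2)).
Proof.
move=> /andP[c0 c1] /andP[x0 x1]; rewrite le_max; apply/orP.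
have [cx|cx] := leP (c / 2) x.
  left; apply: le_trans (expR_ge1Dx _); rewrite lerD2l lerN2.
  by rewrite expr2 -mulrA ler_wpM2l // ltW.
right; have x2 : x < 2^-1 by lra.
have y0 : 0 < 1 - x by lra.
apply: le_trans (expR_ge1Dx _) _.
rewrite /powR gt_eqF // ler_expR.
(* [- ln (1 - x) = ln (1 + x / (1 - x)) <= x / (1 - x) <= 2 * x], since [x < 1/2]. *)
have h : - (2 * x) <= ln (1 - x).
  have e : (1 - x)^-1 = 1 + x / (1 - x) by field; rewrite gt_eqF.
  rewrite lerNl -lnV ?posrE // e.
  apply: le_trans (le_ln1Dx _) _.
    by rewrite (lt_le_trans (y := 0)) ?ltrN10 // divr_ge0 // ltW.
  by rewrite ler_pdivrMr //; nra.
have : c / 2 * - (2 * x) <= c / 2 * ln (1 - x) by rewrite ler_wpM2l // ltW // divr_gt0.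
by lra.
Qed.

Lemma limn_esup_le_eventually (u : nat -> \bar R) (b : R) :
  (forall e : R, 0 < e -> exists N, forall t, (N <= t)%N -> (u t <= (b + e)%:E)%E) ->
  (limn_esup u <= b%:E)%E.
Proof.
move=> h; apply/lee_addgt0Pr => e e0; have [N hN] := h _ e0.
apply: (@le_trans _ _ (ereal_sup (u @` [set t | (N <= t)%N]%classic)%classic)).
  apply: ereal_inf_lbound; exists [set t | (N <= t)%N]%classic => //=.
  by exists N.
by apply: ge_ereal_sup => _ [t /= Nt <-]; rewrite -EFinD; exact: hN.
Qed.

Lemma cvg_root (C : R) : 0 < C -> ((C `^ (t%:R^-1)) @[t --> \oo] --> (1 : R))%classic.
Proof.
move=> C0; rewrite /powR gt_eqF //= -[X in (_ --> X)%classic]expR0.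
have -> : (0 : R) = 0 * ln C by rewrite mul0r.
apply: continuous_cvg; first exact: continuous_expR.
apply: cvgMr_tmp; rewrite -(cvg_shiftS (fun t : nat => t%:R^-1 : R)).
exact: cvg_harmonic.
Qed.

(** The constant disappears in the limit because [C] to the power [1/t] tends to 1. *)
Lemma limn_esup_root_le (f : nat -> R) (C b : R) : 0 < C -> 0 < b ->
  (forall t, (0 < t)%N -> 0 <= f t <= C * b `^ t%:R) ->
  (limn_esup (fun t => ((f t) `^ (t%:R^-1))%:E) <= b%:E)%E.
Proof.
move=> C0 b0 hf; apply: limn_esup_le_eventually => e e0.
have : ((C `^ (t%:R^-1) * b) @[t --> \oo] --> (1 * b : R))%classic.
  by apply: cvgMr_tmp; exact: cvg_root.
rewrite mul1r => /cvgrPdist_le /(_ _ e0)[N _ hN]; exists N.+1 => t Nt.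
have t0 : (0 < t)%N by apply: leq_trans Nt.
rewrite lee_fin; apply: le_trans (_ : C `^ t%:R^-1 * b <= _).
  have /andP[f0 fC] := hf _ t0.
  apply: le_trans (ge0_ler_powR _ _ _ fC) _.
  - by rewrite invr_ge0.
  - by rewrite nnegrE.
  - by rewrite nnegrE; apply: le_trans fC.
  rewrite powRM ?powR_ge0 //; last exact: ltW.
  rewrite -powRrM divff ?pnatr_eq0 -?lt0n // powRr1 //; exact: ltW.
have := hN t (ltnW Nt); rewrite /= ler_distlC => /andP[_].
by [].
Qed.

End Rates.

(** * Lengths of walks modulo [n] in a strongly connected graph *)

Section Walks.
Context {S : finType} (e : rel S).

Definition walk (l : nat) (i j : S) : Prop :=
  exists p : seq S, [/\ path e i p, last i p = j & size p = l].

Lemma walk0 i : walk 0 i i.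
Proof. by exists [::]. Qed.

Lemma walk_cat l1 l2 i j k : walk l1 i j -> walk l2 j k -> walk (l1 + l2) i k.
Proof.
move=> [p [pp <- <-]] [s [ps <- <-]]; exists (p ++ s).
by rewrite cat_path pp ps last_cat size_cat.
Qed.

Lemma walk_mul l i k : walk l i i -> walk (k * l) i i.
Proof.
by move=> h; elim: k => [|k IH]; [exact: walk0|rewrite mulSn; exact: walk_cat IH].
Qed.

Lemma walk_of_connect i j : connect e i j -> exists l, walk l i j.
Proof. by move=> /connectP[p pp ->]; exists (size p), p. Qed.

Hypothesis irr : forall i j, connect e i j.
Variables (n : nat).
Hypothesis n0 : (0 < n)%N.

(* The residue [g] modulo [n] can be added to the length of every walk. *)
Definition free_residue (g : nat) : Prop :=
  forall l i j, walk l i j -> exists l', walk l' i j /\ l' = (l + g)%N %[mod n].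

Lemma free_residue0 : free_residue 0.
Proof. by move=> l i j h; exists l; rewrite addn0. Qed.

Lemma free_residueD g1 g2 :
  free_residue g1 -> free_residue g2 -> free_residue (g1 + g2).
Proof.
move=> h1 h2 l i j /h1[l1 [/h2[l2 [w e2]] e1]]; exists l2; split => //.
by rewrite e2 -modnDml e1 modnDml addnA.
Qed.

Lemma free_residue_mod g g' : g = g' %[mod n] -> free_residue g -> free_residue g'.
Proof.
move=> gg h l i j /h[l' [w e']]; exists l'; split => //.
by rewrite e' -modnDmr gg modnDmr.
Qed.

Lemma free_residueM k g : free_residue g -> free_residue (k * g).
Proof.
move=> h; elim: k => [|k IH]; first exact: free_residue0.
by rewrite mulSn; exact: free_residueD.
Qed.

Lemma free_residue_gcd g1 g2 :
  free_residue g1 -> free_residue g2 -> free_residue (gcdn g1 g2).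
Proof.
have [->|g1p] := posnP g1; first by rewrite gcd0n.
move=> h1 h2; case: (egcdnP g2 g1p) => a b ab _.
(* Bezout gives [a * g1 = b * g2 + gcdn g1 g2]; modulo [n], the factor [n.-1] stands for -1. *)
apply: free_residue_mod (_ : (a * g1 + n.-1 * (b * g2))%N = _ %[mod n]) _.
  by rewrite ab addnAC -mulSn prednK // mulnC modnMDl.
by apply: free_residueD; do ?apply: free_residueM.
Qed.

(** Go from [i] to the cycle, once around it and back, then make the same excursion [n.-1] times
    without the cycle: the [n] excursions add 0 modulo [n], and the cycle adds its length. *)
Lemma free_residue_cycle (c : seq S) :
  (0 < size c)%N -> ucycle e c -> free_residue (size c).
Proof.
case: c => // k c _ /andP[cyc _] l i j w.
have [a wa] := walk_of_connect (irr i k); have [b wb] := walk_of_connect (irr k i).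
have wc : walk (size c).+1 k k.
  by exists (rcons c k); rewrite last_rcons size_rcons.
have w1 := walk_cat wa (walk_cat wc wb).
have w2 := walk_mul n.-1 (walk_cat wa wb).
exists (a + ((size c).+1 + b) + (n.-1 * (a + b) + l))%N; split.
  exact: walk_cat w1 (walk_cat w2 w).
rewrite /= (_ : (_ + _ = n * (a + b) + (l + (size c).+1))%N).
  by rewrite mulnC modnMDl.
by rewrite -{2}(prednK n0) mulSn; lia.
Qed.

(** Since [n] is congruent to 0, both [n] and [d] are free, hence so is their gcd 1. Adding
    [n.-1 * l] to a walk of length [l] makes the length divisible by [n]. *)
Lemma walk_mul_exists d i j : free_residue d -> coprime n d ->
  exists m, walk (m * n) i j.
Proof.
move=> hd cop; have [l w] := walk_of_connect (irr i j).
have h1 : free_residue 1.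
  move: cop; rewrite /coprime gcdnC => /eqP <-.
  apply: free_residue_gcd => //.
  by apply: free_residue_mod free_residue0; rewrite modnn mod0n.
have := free_residueM (n.-1 * l) h1; rewrite muln1.
move=> /(_ _ _ _ w)[l' [w' /eqP]].
rewrite -mulSn prednK // -[_ == _]/(l' == (n * l) %[mod n]) mulnC modnMl.
by move=> /dvdnP[m e']; exists m; rewrite -e'.
Qed.

Lemma exists_ucycle i j : e i j -> exists2 c, (0 < size c <= #|S|)%N & ucycle e c.
Proof.
move=> ij; have /connectP[p pp ei] := irr j i.
case/shortenP: pp ei => p' pp' up' _ ei; exists (j :: p').
  by have := max_card (mem (j :: p')); rewrite (card_uniqP up').
by rewrite /ucycle up' /= rcons_path pp' -ei ij.
Qed.

End Walks.

(** * Stationary law of the state after [n] steps *)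

Section WordMeasure.
Context {R : realType} (M : edge_hmm R).
Hypothesis hM : is_hmm M.

Lemma sum_stat_word_mx n j :
  \sum_(w : n.-tuple (symbol M)) \sum_i stat M i * word_mx w i j = stat M j.
Proof.
elim: n => [|n IH].
  rewrite (sum_tuple0 (fun w => \sum_i stat M i * word_mx w i j)) /=.
  under eq_bigr do rewrite eq_sym mulrC.
  exact: sum_delta_l.
rewrite (sum_tupleS n (fun w => \sum_i stat M i * word_mx w i j)) exchange_big -[RHS]IH.
apply: eq_bigr => w _ /=; rewrite exchange_big /=.
transitivity (\sum_i \sum_k stat M i * transM i k * word_mx w k j).
  apply: eq_bigr => i _; rewrite -mulr_sumr exchange_big /= mulr_sumr.
  by apply: eq_bigr => k _; rewrite -mulr_suml mulrA.
rewrite exchange_big /=; apply: eq_bigr => k _; rewrite -mulr_suml.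
by have [_ _ ->] := stat_stationary hM.
Qed.

End WordMeasure.

(** * The block model: irreducibility and stationary distribution *)

Section BlockModel.
Context {R : realType} (M : edge_hmm R).
Hypothesis (hM : is_hmm M) (Mirr : irreducible_hmm M).
Implicit Types (i j k : state M).

Lemma free_residue_per n : (0 < n)%N -> free_residue (@tgraph R M) n (per M).
Proof.
move=> n0; rewrite /per; elim/big_ind: _ => [|g1 g2|l /existsP[c hc]].
- exact: free_residue0.
- exact: free_residue_gcd.
- by have := free_residue_cycle Mirr n0 (c := c); rewrite size_tuple => /(_ isT hc).
Qed.

Lemma per_gt0 : (0 < per M)%N.
Proof.
have [i] : exists i : state M, True by case: hM => /card_gt0P[i _] _ _; exists i.
have [j ij] : exists j, tgraph i j.
  apply: contrapT => h; have : \sum_j transM i j <= 0.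
    by apply: sumr_le0 => j _; rewrite leNgt; apply/negP => ij; apply: h; exists j.
  by rewrite transM_row // ler10.
move=> _; have [c /andP[c0 cS] hc] := exists_ucycle Mirr ij.
have cS' : ((size c).-1 < #|state M|)%N by rewrite prednK.
apply: (@dvdn_gt0 _ (size c)) => //.
apply: (@biggcdn_inf _ (Ordinal cS')); last by rewrite /= prednK.
have szc : size c == ((size c).-1).+1 by rewrite prednK.
by apply/existsP; exists (Tuple szc).
Qed.

Lemma word_mx_walk l i j : walk (@tgraph R M) l i j ->
  exists2 w : seq (symbol M), size w = l & 0 < word_mx w i j.
Proof.
case=> p [pp <- <-]; elim: p i pp => [|k p IH] i /=.
  by exists [::] => //=; rewrite eqxx.
move=> /andP[ik /IH[w sw wk]]; have [x xk] : exists x : symbol M, 0 < trans x i k.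
  apply: contrapT => h; move: ik; rewrite /tgraph ltNge => /negP; apply.
  by apply: sumr_le0 => x _; rewrite leNgt; apply/negP => xk; apply: h; exists x.
exists (x :: w); first by rewrite /= sw.
rewrite /= (bigD1 k) //= ltr_wpDr ?mulr_gt0 //.
by apply: sumr_ge0 => h _; rewrite mulr_ge0 ?trans_ge0 ?word_mx_ge0.
Qed.

Section Block.
Variable n : nat.
Local Notation B := (block_model M n).

Lemma block_trans (w : symbol B) i j : trans w i j = word_mx (val w : n.-tuple _) i j.
Proof. exact: word_end_prE. Qed.

(** Words missing from the block alphabet have probability 0, and by positivity of [stat M] all
    their entries vanish. *)
Lemma block_transM i j :
  @transM R B i j = \sum_(w : n.-tuple (symbol M)) word_mx w i j.
Proof.
rewrite /transM; under eq_bigr do rewrite block_trans.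
rewrite (bigID (fun w : n.-tuple _ => 0 < word_pr w)) /= [X in _ = _ + X]big1 ?addr0.
  rewrite [RHS](reindex_omap (val : symbol B -> _) insub) /=; last first.
    by move=> w wP; rewrite insubT.
  by apply: eq_bigl => -[w wP] /=; rewrite insubT wP eqxx.
move=> w; rewrite word_prE // -leNgt => w0.
have /emit_eq0 e0 : word_wt w = 0.
  by apply/eqP; rewrite eq_le w0 word_wt_ge0.
by apply/eqP; rewrite eq_le word_mx_ge0 // andbT -(e0 hM Mirr i) word_mx_le_emit.
Qed.

Lemma block_is_hmm : is_hmm B.
Proof.
split; first by case: hM.
  by move=> w i j; rewrite block_trans word_mx_ge0.
move=> i; under eq_bigr do rewrite block_transM.
by rewrite exchange_big /= -(sum_emit hM n i).
Qed.

Lemma block_stationary : is_stationary (stat M : {ffun state B -> R}).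
Proof.
have [h1 h2 _] := stat_stationary hM; split => // j.
under eq_bigr do rewrite block_transM mulr_sumr.
by rewrite exchange_big sum_stat_word_mx.
Qed.

Lemma block_tgraph_walk i j : walk (@tgraph R M) n i j -> @tgraph R B i j.
Proof.
move=> /word_mx_walk[w sw wij]; rewrite /tgraph block_transM.
have szw : size w == n by apply/eqP.
rewrite (bigD1 (Tuple szw)) //= ltr_wpDr // sumr_ge0 // => u _.
exact: word_mx_ge0.
Qed.

Lemma block_connect_walk m i j :
  walk (@tgraph R M) (m * n) i j -> connect (@tgraph R B) i j.
Proof.
elim: m i => [|m IH] i [p [pp lp sp]].
  by move: sp lp; rewrite mul0n => /size0nil -> /= <-.
move: pp lp; rewrite -(cat_take_drop n p) cat_path last_cat => /andP[p1 p2] lp.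
have sp1 : size (take n p) = n by rewrite size_takel // sp mulSn leq_addr.
apply: (connect_trans (y := last i (take n p))).
  by apply/connect1/block_tgraph_walk; exists (take n p).
by apply: IH; exists (drop n p); rewrite p2 lp size_drop sp mulSn addKn.
Qed.

Hypotheses (n0 : (0 < n)%N) (cop : coprime n (per M)).

(** Coprimality provides walks whose length is a multiple of [n]; cut into pieces of length [n],
    they are paths of the block model. *)
Lemma block_irreducible : irreducible_hmm B.
Proof.
move=> i j.
have [m] := walk_mul_exists Mirr n0 i j (free_residue_per n0) cop.
exact: block_connect_walk.
Qed.

Lemma block_stat : stat B = stat M :> {ffun state M -> R}.
Proof. exact (stat_unique block_is_hmm block_irreducible block_stationary). Qed.

Lemma block_word_mx (w : symbol B) i j :
  @word_mx R B [:: w] i j = word_mx (val w : n.-tuple _) i j.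
Proof. by rewrite word_mx1 block_trans. Qed.

Lemma block_emit (w : symbol B) i :
  @emit R B [:: w] i = emit (val w : n.-tuple _) i.
Proof. by rewrite /emit; apply: eq_bigr => j _; rewrite block_word_mx. Qed.

Lemma block_flagP (w : symbol B) (k : state B) :
  flag_symbol w k <->
  forall i, 0 < emit (val w : n.-tuple _) i -> 0 < word_mx (val w : n.-tuple _) i k.
Proof.
have hB := block_is_hmm; have Birr := block_irreducible.
split => h i; have := h i.
  by rewrite delta_neq0 // mem_delta // block_emit block_word_mx.
by rewrite delta_neq0 // mem_delta // block_emit block_word_mx.
Qed.

(** * The flag-state rate of the block model and the resulting bound *)

Section Rate.
Local Arguments word_mx : simpl never.
Variable y : state B -> symbol B.
Hypothesis flag_y : forall j, flag_symbol (y j) j.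
Let yw j : n.-tuple (symbol M) := val (y j).

(** Block symbols have positive probability by construction; this makes p_* positive. *)
Lemma flag_emit j : exists i, 0 < emit (yw j) i.
Proof.
apply: contrapT => h; have := valP (y j); rewrite word_prE // ltNge => /negP; apply.
apply: sumr_le0 => i _; rewrite mulr_ge0_le0 ?stat_ge0 // leNgt.
by apply/negP => yi; apply: h; exists i.
Qed.

Lemma block_p_cond j :
  condPr [pred o : traj B 1 | tnth o.2 ord0 == y j]
         [pred o : traj B 1 | last_state o == j] =
  (\sum_i stat M i * word_mx (yw j) i j) / stat M j.
Proof.
have hB := block_is_hmm; have Birr := block_irreducible.
rewrite /condPr; congr (_ / _).
  rewrite (Pr_traj (fun _ (w : 1.-tuple (symbol B)) k =>
    (tnth w ord0 == y j) && (k == j))).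
  have e : tnth [tuple y j] ord0 = y j by [].
  rewrite (bigD1 [tuple y j]) //= [X in _ + X]big1 ?addr0.
    rewrite block_stat; apply: eq_bigr => i _.
    rewrite (bigD1 j) //= [X in _ + X]big1 ?addr0.
      by rewrite e (eqxx (y j)) (eqxx j) mulr1 block_word_mx.
    by move=> k /negPf ->; rewrite andbF mulr0.
  move=> w wy; rewrite big1 // => i _; rewrite big1 // => k _.
  suff -> : (tnth w ord0 == y j) = false by rewrite mulr0.
  apply: contraNF wy => /eqP wy; apply/eqP/eq_from_tnth => t.
  by rewrite ord1 wy.
rewrite (Pr_traj (fun _ (w : 1.-tuple (symbol B)) k => k == j)).
transitivity (\sum_(w : 1.-tuple (symbol B)) \sum_i stat B i * word_mx w i j).
  apply: eq_bigr => w _; apply: eq_bigr => i _.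
  rewrite (bigD1 j) //= eqxx mulr1 [X in _ + X]big1 ?addr0 // => k /negPf ->.
  by rewrite mulr0.
by rewrite (sum_stat_word_mx hB 1 j) block_stat.
Qed.

Lemma p_star_bounds : 0 < p_star y <= 1.
Proof.
rewrite /p_star bigmin_le_id andbT; apply: lt_bigmin => // j _.
rewrite block_p_cond divr_gt0 ?stat_gt0 //.
have [i yi] := flag_emit j.
rewrite (bigD1 i) //= ltr_wpDr ?mulr_gt0 ?stat_gt0 //.
  by apply: sumr_ge0 => k _; rewrite mulr_ge0 ?stat_ge0 ?word_mx_ge0.
exact: (block_flagP (y j) j).1.
Qed.

Lemma p_star_le (j : state M) :
  p_star y * stat M j <= \sum_i stat M i * word_mx (yw j) i j.
Proof.
by rewrite -ler_pdivlMr ?stat_gt0 // -block_p_cond; exact: bigmin_le.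
Qed.

Lemma q_star_bounds : 0 < q_star y <= 1.
Proof.
have hB := block_is_hmm; have Birr := block_irreducible.
rewrite /q_star bigmin_le_id andbT; apply: lt_bigmin => // j _.
apply: lt_bigmin => // i.
rewrite !word_pr_fromE // !word_end_prE // block_emit block_word_mx => yi.
by rewrite divr_gt0 //; exact: (block_flagP (y j) j).1.
Qed.

Lemma q_star_le (i j : state M) : q_star y * emit (yw j) i <= word_mx (yw j) i j.
Proof.
have hB := block_is_hmm; have Birr := block_irreducible.
have := emit_ge0 hM (yw j) i; rewrite le_eqVlt => /orP[/eqP <-|yi].
  by rewrite mulr0 word_mx_ge0.
rewrite -ler_pdivlMr //.
apply: (@bigmin_inf _ _ _ _ j) => //; apply: (@bigmin_inf _ _ _ _ i).
  by rewrite word_pr_fromE // block_emit.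
by rewrite !word_pr_fromE // !word_end_prE // block_emit block_word_mx.
Qed.

Lemma r_star_bounds : 0 < @r_star R B <= 1.
Proof.
rewrite /r_star bigmin_le_id andbT; apply: lt_bigmin => // i _.
by apply: lt_bigmin => // j _; rewrite block_stat divr_gt0 ?stat_gt0.
Qed.

Lemma r_star_le (i j : state M) : @r_star R B * stat M j <= stat M i.
Proof.
rewrite -ler_pdivlMr ?stat_gt0 // -block_stat.
by apply: (@bigmin_inf _ _ _ _ i) => //; exact: bigmin_le.
Qed.

Let N : R := #|state M|%:R.
(** Twice [eta_rate]; in terms of [c] both alphas take the form used in [one_sub_mul_le_max]. *)
Let c := p_star y * @r_star R B / N.

Lemma card_ge1 : 1 <= N.
Proof. by case: hM => h _ _; rewrite ler1n. Qed.

Lemma c_bounds : 0 < c <= 1.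
Proof.
have /andP[p0 p1] := p_star_bounds; have /andP[r0 r1] := r_star_bounds.
have N1 := card_ge1; have N0 : 0 < N by apply: lt_le_trans N1.
rewrite /c divr_gt0 ?mulr_gt0 //= ler_pdivrMr // mul1r (le_trans _ N1) //.
by rewrite mulr_ile1 // ltW.
Qed.

Lemma alpha1E : alpha1 y = expR (- (c ^+ 2 / 2)).
Proof.
rewrite /alpha1; congr (expR (- _)); rewrite -/N /c.
by field; rewrite gt_eqF // (lt_le_trans _ card_ge1).
Qed.

Lemma alpha2E : alpha2 y = (1 - q_star y ^+ 2) `^ (c / 2).
Proof.
rewrite /alpha2 /eta_rate; congr (_ `^ _); rewrite -/N /c.
by field; rewrite gt_eqF // (lt_le_trans _ card_ge1).
Qed.

Lemma q2_bounds : 0 < q_star y ^+ 2 <= 1.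
Proof.
have /andP[q0 q1] := q_star_bounds.
by rewrite exprn_gt0 //= expr_le1 // ltW.
Qed.

Lemma flag_rate_bounds : 0 < flag_rate y < 1.
Proof.
have /andP[c0 c1] := c_bounds; have /andP[q0 q1] := q2_bounds.
rewrite /flag_rate lt_max gt_max alpha1E alpha2E expR_gt0 /=.
apply/andP; split; first by rewrite expR_lt1 oppr_lt0 divr_gt0 ?exprn_gt0.
(* If q_* = 1, then [alpha2] is a positive power of 0, hence 0; the logarithm serves only the other
   case. *)
have [->|q2] := eqVneq (q_star y ^+ 2) 1.
  by rewrite subrr powR0 // gt_eqF // divr_gt0.
have q3 : q_star y ^+ 2 < 1 by rewrite lt_neqAle q2.
have c2 : 0 < c / 2 by exact: divr_gt0.
rewrite /powR gt_eqF ?subr_gt0 // expR_lt1 pmulr_rlt0 //.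
by rewrite ln_lt0 // subr_gt0 q3 gtrBl.
Qed.

Lemma estimate_limsup_flag :
  (estimate_limsup M <= (flag_rate y `^ (n%:R^-1))%:E)%E.
Proof.
have /andP[a0 a1] := flag_rate_bounds.
set a := flag_rate y in a0 a1 *.
have /andP[c0 c1] := c_bounds; have /andP[q0 q1] := q2_bounds.
have /andP[p0 _] := p_star_bounds; have /andP[r0 _] := r_star_bounds.
have /andP[qs0 qs1] := q_star_bounds.
have ca : 1 - c * q_star y ^+ 2 <= a.
  rewrite /a /flag_rate alpha1E alpha2E.
  by apply: one_sub_mul_le_max; rewrite ?c0 ?c1 ?q0 ?q1.
have c2 : 0 <= 1 - c * q_star y ^+ 2 by rewrite subr_ge0 mulr_ile1 // ltW.
pose K : R := #|symbol M|%:R / ln 2.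
have K0 : 0 <= K by rewrite divr_ge0 // ltW // ln2_gt0.
have [s0] : exists i : state M, True by case: hM => /card_gt0P[i _] _ _; exists i.
(* The [+ 1] makes the constant visibly positive. The division by [a] pays for rounding and for the
   index shift: [t %/ n + 1 >= (t + 1) / n] and [a < 1]. *)
move=> _; apply: (@limn_esup_root_le _ _ ((K + 1) / a)).
- by rewrite divr_gt0 // ltr_wpDl.
- by rewrite powR_gt0.
case=> // t _; rewrite (entropy_estimateE hM Mirr) subr_ge0 entropy_rate_le //=.
rewrite (divn_eq t n).
have qs : 0 <= q_star y <= 1 by rewrite qs1 ltW.
have := @entropy_incr_rate_bound _ _ hM Mirr n yw (p_star y) (q_star y) (@r_star R B) s0
  qs (ltW p0) (ltW r0) q_star_le p_star_le r_star_le (t %/ n) (t %% n) c2.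
move=> /le_trans; apply; rewrite -/K -divn_eq.
apply: le_trans (_ : (K + 1) * a ^+ (t %/ n) <= _).
  by rewrite ler_pM ?exprn_ge0 ?lerDl // lerXn2r // nnegrE // ltW.
rewrite -mulrA ler_wpM2l ?addr_ge0 //.
rewrite mulrC ler_pdivlMr // -exprSr -powRrM -powR_mulrn; last exact: ltW.
apply: ger_powR; first by rewrite a0 ltW.
rewrite mulrC ler_pdivrMr ?ltr0n // -natrM ler_nat.
by rewrite mulSn {1}(divn_eq t n) addnC ltn_add2r ltn_mod.
Qed.

End Rate.
End Block.
End BlockModel.

(** * Path-mergeable models have a flag-state block model *)

Section PathMergeable.
Context {R : realType} (M : edge_hmm R).
Hypothesis (hM : is_hmm M) (Mirr : irreducible_hmm M) (merge : path_mergeable M).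
Implicit Types (u v w : seq (symbol M)) (i j k : state M).

Lemma word_mx_cat_gt0 u v i j k :
  0 < word_mx u i k -> 0 < word_mx v k j -> 0 < word_mx (u ++ v) i j.
Proof.
move=> uk vj; rewrite word_mx_cat (bigD1 k) //= ltr_wpDr ?mulr_gt0 //.
by apply: sumr_ge0 => l _; rewrite mulr_ge0 ?word_mx_ge0.
Qed.

Lemma emit_cat_gt0 u v i : 0 < emit (u ++ v) i ->
  exists2 k, 0 < word_mx u i k & 0 < emit v k.
Proof.
rewrite emit_cat => uv; apply: contrapT => h; move: uv; rewrite ltNge => /negP; apply.
apply: sumr_le0 => k _; rewrite leNgt; apply/negP => p.
have := word_mx_ge0 hM u i k; rewrite le_eqVlt => /orP[/eqP e|uk].
  by move: p; rewrite -e mul0r ltxx.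
by apply: h; exists k => //; rewrite -(pmulr_rgt0 _ uk).
Qed.

(** The first clause excludes words that no state can emit, for which the second would be
    vacuous. *)
Definition synchronizes w k (s : seq (state M)) : Prop :=
  (exists i, 0 < word_mx w i k) /\
  (forall i, i \in s -> 0 < emit w i -> 0 < word_mx w i k).

(** Add one state [l] at a time. If [l] can emit [w] and end in [h], a word merging [h] and [k] is
    appended; states of [s] that emit the longer word also emit [w], so they reach [k] and then the
    merged state. *)
Lemma synchronizing_word (s : seq (state M)) : exists w k, synchronizes w k s.
Proof.
elim: s => [|l s [w [k [[i0 i0k] wk]]]].
  have [k] : exists k : state M, True by case: hM => /card_gt0P[k _] _ _; exists k.
  by exists [::], k; split => //; exists k; rewrite /= eqxx.
have [/emit_gt0[h wh]|wl] := ltP 0 (emit w l); last first.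
  exists w, k; split=> [|i]; first by exists i0.
  by rewrite inE => /predU1P[->|/wk//]; rewrite ltNge wl.
have [hk|hk] := eqVneq h k.
  exists w, k; split=> [|i]; first by exists i0.
  by rewrite inE => /predU1P[->|/wk//]; rewrite -{1}hk.
have [v [g]] := merge hk; rewrite finset.in_setI !mem_delta // => /andP[hg kg].
exists (w ++ v), g; split; first by exists i0; exact: word_mx_cat_gt0 kg.
move=> i; rewrite inE => /predU1P[-> _|si /emit_cat_gt0[j wj _]].
  exact: word_mx_cat_gt0 hg.
apply: word_mx_cat_gt0 kg; apply: wk => //.
exact: lt_le_trans wj (word_mx_le_emit _ _ _ _).
Qed.

Lemma synchronizing_word_at k : exists w, synchronizes w k (enum (state M)).
Proof.
have [w [h [[i wi] wh]]] := synchronizing_word (enum (state M)).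
have [l hk] := walk_of_connect (Mirr h k).
have [v _ vk] := word_mx_walk hM hk.
exists (w ++ v); split; first by exists i; exact: word_mx_cat_gt0 vk.
move=> j js /emit_cat_gt0[g wg _]; apply: word_mx_cat_gt0 vk; apply: wh => //.
exact: lt_le_trans wg (word_mx_le_emit _ _ _ _).
Qed.

Lemma synchronizes_cat u w h i k :
  synchronizes w k (enum (state M)) -> 0 < word_mx u h i -> 0 < word_mx w i k ->
  synchronizes (u ++ w) k (enum (state M)).
Proof.
move=> [_ wk] uh ik; split; first by exists h; exact: word_mx_cat_gt0 uh ik.
move=> j _ /emit_cat_gt0[g ug wg]; apply: word_mx_cat_gt0 ug _.
by apply: wk => //; rewrite mem_enum.
Qed.

(** S_n has the stationary law, which charges [k]. Used to pad synchronizing words at the front. *)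
Lemma word_into n k : exists2 u, size u = n & exists i, 0 < word_mx u i k.
Proof.
apply: contrapT => h; have := stat_gt0 hM Mirr k; rewrite ltNge => /negP; apply.
rewrite -(sum_stat_word_mx hM n); apply: sumr_le0 => u _; apply: sumr_le0 => i _.
rewrite mulr_ge0_le0 ?stat_ge0 // leNgt; apply/negP => ui.
by apply: h; exists u; [exact: size_tuple|exists i].
Qed.

Lemma exists_flag_block :
  exists n, [/\ (0 < n)%N, coprime n (per M) & flag_state (block_model M n)].
Proof.
have [f hf] := boolp.choice synchronizing_word_at.
(* This [n] is congruent to 1 modulo the period, hence coprime to it, and at least [L] because the
   period is positive; so each [f k] can be padded to length [n]. *)
pose L := (\max_k size (f k))%N; pose n := (1 + L * per M)%N.
have n0 : (0 < n)%N by [].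
have cop : coprime n (per M) by rewrite coprime_sym /coprime /n addnC gcdnMDl gcdn1.
exists n; split => // k.
have fn : (size (f k) <= n)%N.
  have := leq_bigmax (F := fun k => size (f k)) k; rewrite -/L => /leq_trans; apply.
  by rewrite (leq_trans (leq_pmulr L (per_gt0 hM Mirr))) // leq_addl.
have [[i wi] _] := hf k; have [u su [h uh]] := word_into (n - size (f k)) i.
have [[g gk] sync] := synchronizes_cat (hf k) uh wi.
have sz : size (u ++ f k) == n by rewrite size_cat su subnK.
have pr : 0 < word_pr (Tuple sz).
  rewrite word_prE //; apply: (word_wt_gt0 hM Mirr (i := g)).
  exact: lt_le_trans gk (word_mx_le_emit _ _ _ _).
exists (Sub (Tuple sz) pr); apply/block_flagP => // j.
by rewrite SubK; apply: sync; rewrite mem_enum.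
Qed.

Lemma estimate_limsup_lt1 : (estimate_limsup M < 1%:E)%E.
Proof.
have [n [n0 cop flag]] := exists_flag_block.
have [y flag_y] := boolp.choice flag.
apply: le_lt_trans (estimate_limsup_flag hM Mirr n0 cop flag_y) _.
have /andP[a0 a1] := flag_rate_bounds hM Mirr n0 cop flag_y.
rewrite lte_fin /powR gt_eqF // expR_lt1 pmulr_rlt0 ?invr_gt0 ?ltr0n //.
by rewrite ln_lt0 // a0.
Qed.

End PathMergeable.

Theorem theorem2 (R : realType) (M : edge_hmm R)
    (hM : is_hmm M) (Mirr : irreducible_hmm M) (Msymb : all_symbols_occur M) :
  (forall n : nat, (0 < n)%N -> coprime n (per M) ->
     flag_state (block_model M n) ->
     forall y : state (block_model M n) -> symbol (block_model M n),
       (forall j, flag_symbol (y j) j) ->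
       0 < flag_rate y < 1 /\
       (estimate_limsup M <= (flag_rate y `^ (n%:R^-1))%:E)%E) /\
  (path_mergeable M -> (estimate_limsup M < 1%:E)%E).
Proof.
split=> [n n0 cop _ y flag_y|]; last exact: estimate_limsup_lt1.
split; first exact (flag_rate_bounds hM Mirr n0 cop flag_y).
exact (estimate_limsup_flag hM Mirr n0 cop flag_y).
Qed.
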